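(* Let $G$ be a non-elementary generalized Baumslag–Solitar group, let $\mathcal A$ be a family of cyclic subgroups of $G$ stable under conjugation and under taking subgroups, and let $\mathcal D^{\mathcal A}$ be the corresponding restricted deformation space. Let $\mathcal G\subset G$ be a finite collection of loxodromic elements. If $\mathcal G$ is simple with respect to $\mathcal D^{\mathcal A}$, then for all $T\in\mathcal D^{\mathcal A}$ there exists a vertex $v\in T$ such that the Whitehead graph $Wh_T(\mathcal G,v)$ has an admissible cut for $\mathcal A$.
   Context: A generalized Baumslag–Solitar (GBS) group is the fundamental group of a finite graph of groups all of whose vertex and edge groups are infinite cyclic. It is non-elementary if it is not isomorphic to $\mathbb Z$, $\mathbb Z^2$ or the Klein bottle group $\langle a,t\mid tat^{-1}=a^{-1}\rangle$. A $G$-tree is a simplicial tree with a minimal action of $G$ by simplicial automorphisms without inversions. A subgroup is elliptic (resp. bi-elliptic) in a $G$-tree if it fixes a vertex (resp. an edge). The cyclic deformation space $\mathcal D$ is the set of all $G$-trees whose vertex and edge stabilizers are all infinite cyclic; all trees in $\mathcal D$ have the same elliptic subgroups. The restricted deformation space $\mathcal D^{\mathcal A}$ is the set of trees in $\mathcal D$ all of whose bi-elliptic subgroups belong to $\mathcal A$. An element of $G$ is loxodromic if it fixes no point in one (equivalently, every) tree of $\mathcal D$; it then has an axis in each such tree. Collapses: given a $G$-invariant subforest $F$ of a $G$-tree $T$, the collapse of $F$ is the $G$-tree obtained by contracting each component of $F$ to a point. $\bar{\mathcal D}^{\mathcal A}$ denotes the set of all trees obtained by collapsing (possibly empty, possibly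 full) $G$-invariant subforests in trees of $\mathcal D^{\mathcal A}$, including the trivial tree. Systems of special factors: a system of special factors with respect to $\mathcal D^{\mathcal A}$ is a finite collection of conjugacy classes of subgroups $\mathcal H=\{[H_1],\dots,[H_k]\}$ such that there is $T_{\mathcal H}\in\bar{\mathcal D}^{\mathcal A}$ for which $\mathcal H$ is the set of conjugacy classes of vertex stabilizers of $T_{\mathcal H}$ which are not elliptic in $\mathcal D$. It is proper if it is not $\{[G]\}$. One writes $\mathcal G\preceq\mathcal H$ if every $g\in\mathcal G$ is contained in a conjugate of some $H_i$. The collection $\mathcal G$ is simple (with respect to $\mathcal D^{\mathcal A}$) if there is a proper system of special factors $\mathcal H$ with $\mathcal G\preceq\mathcal H$. Whitehead graph: for a vertex $v$ of $T\in\mathcal D^{\mathcal A}$, let $\mathcal E_v$ be the set of edges with origin $v$. $Wh_T(\mathcal G,v)$ is the simplicial graph with vertex set $\mathcal E_v$, in which two distinct vertices $e,e'$ are joined by an edge when some conjugate of some $g\in\mathcal G$ has an axis in $T$ containing $e\cup e'$. The stabilizer $G_v$ acts on $Wh_T(\mathcal G,v)$. When $Wh_T(\mathcal G,v)$ is not connected, an admissible connected component is a connected component whose stabilizer (in $G_v$) belongs to $\mathcal A$. A vertex $p$ of $Wh_T(\mathcal G,v)$, with connected component $W_0\ni p$, is an admissible cut point if $W_0\setminus\{p\}$ is disconnected and there is a connected component $A$ of $W_0\setminus\{p\}$ with $A\cap G_v\cdot p=\varnothing$. The graph $Wh_T(\mathcal G,v)$ has an admissible cut (for $\mathcal A$)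 if it has an admissible connected component or an admissible cut point. *)

(* Defs.v *)
From mathcomp Require Import all_boot all_order all_algebra.
From mathcomp Require Import boolp classical_sets functions cardinality.
From Stdlib Require Import Relation_Operators.

Set Implicit Arguments.
Unset Strict Implicit.
Unset Printing Implicit Defensive.

Local Open Scope classical_set_scope.
Local Open Scope group_scope.

(* Groups are MathComp [groupType]s (possibly infinite); subgroups are
   classical sets of elements. *)

Definition expgz (G : groupType) (a : G) (n : int) : G :=
  match n with Posz k => a ^+ k | Negz k => (a ^+ k.+1)^-1 end.

Definition is_subgroup (G : groupType) (H : set G) : Prop :=
  [/\ H 1, (forall x y, H x -> H y -> H (x * y)) & (forall x, H x -> H x^-1)].

Definition is_cyclic (G : groupType) (H : set G) : Prop :=
  exists a : G, H = range (expgz a).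

Definition is_infinite_cyclic (G : groupType) (H : set G) : Prop :=
  exists2 a : G, injective (expgz a) & H = range (expgz a).

(* Not MathComp's [H :^ g]: this is the left convention g H g^-1. *)
Definition conj_sub (G : groupType) (g : G) (H : set G) : set G :=
  [set g * h * g^-1 | h in H].

Definition conj_class (G : groupType) (H : set G) : set (set G) :=
  [set conj_sub g H | g in [set: G]].

Definition generates (G : groupType) (S : set G) : Prop :=
  forall H : set G, is_subgroup H -> S `<=` H -> H = [set: G].

(* [presents Rel f]: G is the group presented by the generators X, sent to G
   by f, and the relations Rel, where [Rel K h] says that the images h of the
   generators in K satisfy the relations. Uniqueness in the universal property
   follows from generation. *)
Definition presents (X : Type) (Rel : forall K : groupType, (X -> K) -> Prop)
    (G : groupType) (f : X -> G) : Prop :=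
  [/\ Rel G f,
      generates (range f)
    & forall (K : groupType) (h : X -> K), Rel K h ->
        exists2 phi : G -> K,
          {morph phi : x y / x * y} & forall x, phi (f x) = h x].

(* Graphs in the sense of Serre: oriented edges and an orientation reversal. *)
Record sgraph := SGraph {
  vert : Type;
  edge : Type;
  org : edge -> vert;
  erev : edge -> edge;
  erev_involutive : forall e, erev (erev e) = e;
  erev_neq : forall e, erev e <> e }.

Definition term (X : sgraph) (e : edge X) : vert X := org (erev e).

(* [epath F u s v]: s is an edge path from u to v with all its edges in F. *)
Fixpoint epath (X : sgraph) (F : set (edge X))
    (u : vert X) (s : seq (edge X)) (v : vert X) : Prop :=
  match s with
  | [::] => u = v
  | e :: s' => [/\ F e, org e = u & epath F (term e) s' v]
  end.

Fixpoint no_backtrack (X : sgraph) (s : seq (edge X)) : Prop :=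
  match s with
  | [::] => True
  | e :: s' =>
      match s' with [::] => True | e' :: _ => e' <> erev e end /\ no_backtrack s'
  end.

Definition connected_in (X : sgraph) (F : set (edge X)) (u v : vert X) : Prop :=
  exists s, epath F u s v.

(* The subgraph with all the vertices of X and edge set F is a tree. *)
Definition spans_tree (X : sgraph) (F : set (edge X)) : Prop :=
  [/\ inhabited (vert X),
      (forall e, F e -> F (erev e)),
      (forall u v, connected_in F u v)
    & forall u s, epath F u s u -> no_backtrack s -> s = [::]].

Definition is_tree (X : sgraph) : Prop := spans_tree [set: edge X].

(* Each edge is given with a chosen orientation, from [gsrc] to [gtgt]. *)
Record graph_of_groups := GraphOfGroups {
  gvert : finType;
  gedge : finType;
  gsrc : gedge -> gvert;
  gtgt : gedge -> gvert;
  vgrp : gvert -> groupType;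
  egrp : gedge -> groupType;
  isrc : forall e, egrp e -> vgrp (gsrc e);
  itgt : forall e, egrp e -> vgrp (gtgt e);
  isrc_morph : forall e, {morph @isrc e : x y / x * y};
  itgt_morph : forall e, {morph @itgt e : x y / x * y};
  isrc_inj : forall e, injective (@isrc e);
  itgt_inj : forall e, injective (@itgt e) }.

Section Pi1.
Variable Gam : graph_of_groups.

(* (e, true) is e with its chosen orientation, (e, false) its reversal. *)
Definition gorg (d : gedge Gam * bool) : gvert Gam :=
  if d.2 then gsrc d.1 else gtgt d.1.
Definition grev (d : gedge Gam * bool) : gedge Gam * bool := (d.1, ~~ d.2).

Fact grev_involutive d : grev (grev d) = d.
Proof. by case: d => e b; rewrite /grev /= negbK. Qed.

Fact grev_neq d : grev d <> d.
Proof. by case: d => e []. Qed.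

Definition ggraph : sgraph := SGraph gorg grev_involutive grev_neq.

Definition maximal_tree (Th : set (gedge Gam)) : Prop :=
  @spans_tree ggraph [set d | Th d.1].

(* Generators of pi_1: the elements of the vertex groups and one stable letter
   per edge. *)
Definition pi1_gen : Type := ({v : gvert Gam & vgrp v} + gedge Gam)%type.

Definition vgen (v : gvert Gam) (x : vgrp v) : pi1_gen :=
  inl (existT (fun w => vgrp w : Type) v x).
Definition egen (e : gedge Gam) : pi1_gen := inr e.

Definition pi1_rel (Th : set (gedge Gam)) (K : groupType) (h : pi1_gen -> K) :
    Prop :=
  [/\ (forall v, {morph (fun x => h (@vgen v x)) : x y / x * y}),
      (forall e (c : egrp e),
         h (egen e) * h (vgen (itgt c)) * (h (egen e))^-1 = h (vgen (isrc c)))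
    & forall e, Th e -> h (egen e) = 1].

Definition is_fundamental_group (G : groupType) : Prop :=
  exists2 Th : set (gedge Gam), maximal_tree Th
    & exists f : pi1_gen -> G, presents (@pi1_rel Th) f.

End Pi1.

Definition is_GBS (G : groupType) : Prop :=
  exists Gam : graph_of_groups,
    [/\ (forall v : gvert Gam, is_infinite_cyclic [set: vgrp v]),
        (forall e : gedge Gam, is_infinite_cyclic [set: egrp e])
      & is_fundamental_group Gam G].

Definition is_Z (G : groupType) : Prop := is_infinite_cyclic [set: G].

Definition is_Z2 (G : groupType) : Prop :=
  exists2 f : int * int -> G, bijective f
    & {morph f : x y / (x + y)%R >-> x * y}.

(* Generators: a = h true, t = h false. *)
Definition klein_rel (K : groupType) (h : bool -> K) : Prop :=
  h false * h true * (h false)^-1 = (h true)^-1.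

Definition is_Klein (G : groupType) : Prop :=
  exists f : bool -> G, presents klein_rel f.

Definition non_elementary (G : groupType) : Prop :=
  [/\ ~ is_Z G, ~ is_Z2 G & ~ is_Klein G].

(* A G-tree, with its left action of G; the action is minimal: the only
   G-invariant subtree (W, F) is the whole tree. *)
Record gtree (G : groupType) := GTree {
  tgraph :> sgraph;
  vact : G -> vert tgraph -> vert tgraph;
  eact : G -> edge tgraph -> edge tgraph;
  vact1 : forall v, vact 1 v = v;
  vactM : forall g h v, vact (g * h) v = vact g (vact h v);
  eact1 : forall e, eact 1 e = e;
  eactM : forall g h e, eact (g * h) e = eact g (eact h e);
  act_org : forall g e, org (eact g e) = vact g (org e);
  act_rev : forall g e, erev (eact g e) = eact g (erev e);
  no_inversion : forall g e, eact g e <> erev e;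
  gtree_tree : is_tree tgraph;
  gtree_minimal : forall (W : set (vert tgraph)) (F : set (edge tgraph)),
    W !=set0 ->
    (forall e, F e -> W (org e) /\ F (erev e)) ->
    (forall u v, W u -> W v -> connected_in F u v) ->
    (forall g v, W v -> W (vact g v)) ->
    (forall g e, F e -> F (eact g e)) ->
    W = [set: vert tgraph] /\ F = [set: edge tgraph] }.

Section DeformationSpaces.
Variable G : groupType.

Definition vstab (T : gtree G) (v : vert T) : set G := [set g | vact g v = v].
Definition estab (T : gtree G) (e : edge T) : set G := [set g | eact g e = e].

Definition elliptic (T : gtree G) (H : set G) : Prop :=
  exists v : vert T, H `<=` vstab v.

Definition bi_elliptic (T : gtree G) (H : set G) : Prop :=
  exists e : edge T, H `<=` estab e.

(* The cyclic deformation space. *)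
Definition in_D (T : gtree G) : Prop :=
  (forall v : vert T, is_infinite_cyclic (vstab v)) /\
  (forall e : edge T, is_infinite_cyclic (estab e)).

Definition elliptic_in_D (H : set G) : Prop :=
  exists2 T : gtree G, in_D T & elliptic T H.

(* As the action is without inversions, an element fixing a point of the
   geometric realization fixes a vertex. *)
Definition loxodromic (g : G) : Prop :=
  exists2 T : gtree G, in_D T & forall v : vert T, vact g v <> v.

Definition cyclic_family (A : set (set G)) : Prop :=
  [/\ (forall H, A H -> is_cyclic H),
      (forall H g, A H -> A (conj_sub g H))
    & (forall H K, A H -> is_subgroup K -> K `<=` H -> A K)].

Variable A : set (set G).

(* The restricted deformation space. *)
Definition in_DA (T : gtree G) : Prop :=
  in_D T /\ forall H, is_subgroup H -> bi_elliptic T H -> A H.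

(* The G-tree T' is the collapse of the G-invariant subforest of T with edge
   set F. Isolated vertices of the subforest are irrelevant to the collapse.
   The map q is the quotient map on vertices, and j identifies the edges of T'
   with the edges of T outside F. *)
Definition is_collapse (T : gtree G) (F : set (edge T)) (T' : gtree G) : Prop :=
  [/\ (forall e, F e -> F (erev e)),
      (forall g e, F e -> F (eact g e))
    & exists (q : vert T -> vert T') (j : edge T' -> edge T),
      [/\ (forall v', exists v, q v = v'),
          (forall u v, q u = q v <-> connected_in F u v),
          (injective j /\ range j = ~` F),
          (forall e', org e' = q (org (j e')) /\ j (erev e') = erev (j e'))
        & (forall g v, q (vact g v) = vact g (q v)) /\
          (forall g e', j (eact g e') = eact g (j e'))]].

(* The trivial tree is obtained for F = setT. *)
Definition in_DA_bar (T' : gtree G) : Prop :=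
  exists2 T : gtree G, in_DA T & exists F, is_collapse (T := T) F T'.

(* Systems are sets of conjugacy classes of subgroups. *)
Definition special_factor_system (Hs : set (set (set G))) : Prop :=
  finite_set Hs /\
  exists2 TH : gtree G, in_DA_bar TH
    & Hs = [set conj_class (vstab v)
             | v in [set v : vert TH | ~ elliptic_in_D (vstab v)]].

Definition proper_system (Hs : set (set (set G))) : Prop :=
  Hs <> [set conj_class [set: G]].

Definition preceq (GG : set G) (Hs : set (set (set G))) : Prop :=
  forall g, GG g -> exists2 C, Hs C & exists2 H, C H & H g.

Definition simple_collection (GG : set G) : Prop :=
  exists Hs, [/\ special_factor_system Hs, proper_system Hs & preceq GG Hs].

End DeformationSpaces.

(* Connectedness, in the graph with adjacency relation R (symmetric in the
   uses below), of the full subgraph on a set S of vertices. *)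
Section SubgraphConnectedness.
Variables (X : Type) (R : X -> X -> Prop).

Definition joined (S : set X) : X -> X -> Prop :=
  clos_refl_trans X (fun x y => [/\ S x, S y & R x y]).

Definition component (S : set X) (x : X) : set X :=
  [set y | S y /\ joined S x y].

Definition is_component (S : set X) (C : set X) : Prop :=
  exists2 x, S x & C = component S x.

Definition disconnected (S : set X) : Prop :=
  exists x y, [/\ S x, S y & ~ joined S x y].

End SubgraphConnectedness.

Section Whitehead.
Variables (G : groupType) (T : gtree G).

(* The axis of h, as the bi-infinite path without backtracking along which h
   translates. *)
Definition is_axis (h : G) (p : int -> edge T) : Prop :=
  [/\ (forall i : int, org (p (i + 1)%R) = term (p i)),
      (forall i : int, p (i + 1)%R <> erev (p i))
    & exists2 l : int, (0 < l)%R & forall i : int, eact h (p i) = p (i + l)%R].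

Definition on_axis (p : int -> edge T) (e : edge T) : Prop :=
  exists i : int, p i = e \/ p i = erev e.

Variables (GG : set G) (v : vert T).

Definition wh_vertices : set (edge T) := [set e | org e = v].

Definition wh_adj (e e' : edge T) : Prop :=
  [/\ wh_vertices e, wh_vertices e', e <> e'
    & exists g x p, [/\ GG g, is_axis (x * g * x^-1) p, on_axis p e
                      & on_axis p e']].

(* The setwise stabilizer of C in G_v. *)
Definition wh_stab (C : set (edge T)) : set G :=
  [set g | vstab v g /\ [set eact g e | e in C] = C].

Variable A : set (set G).

Definition admissible_component (C : set (edge T)) : Prop :=
  [/\ disconnected wh_adj wh_vertices, is_component wh_adj wh_vertices C
    & A (wh_stab C)].

Definition admissible_cut_point (p : edge T) : Prop :=
  wh_vertices p /\
  let W := component wh_adj wh_vertices p `\ p in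
  disconnected wh_adj W /\
  exists2 C, is_component wh_adj W C & forall g, vstab v g -> ~ C (eact g p).

Definition has_admissible_cut : Prop :=
  (exists C, admissible_component C) \/ (exists p, admissible_cut_point p).

End Whitehead.

(* Main.v *)
Require Import Defs.
From mathcomp Require Import all_boot all_order all_algebra.
From mathcomp Require Import boolp classical_sets functions cardinality.
From mathcomp Require Import zify.
From Stdlib Require Import Relation_Operators.
From Stdlib Require List.

(** Let [S] be a tree of the restricted deformation space with a collapse in which
    the given elements are elliptic, and let [e] be an edge of [S] that is not
    collapsed. The axes in [S] of the conjugates of the given elements avoid [e],
    so that the partition of the vertices of [S] into the two sides of [e] never
    separates the two ends of such an axis. The proof pulls this partition back
    to [T] and reads off a cut in a Whitehead graph of [T]. (Without any given
    element, Whitehead graphs have no edges and the claim is immediate.)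

    Vertex groups of [T] fix vertices of [S] ([vertex_groups_elliptic]), whence an
    equivariant map [f] from the vertices of [T] to those of [S]. Indeed, all
    conjugates of a vertex group of [T] are commensurable, so a vertex group that
    is not elliptic in [S] has a [G]-invariant axis there; then [S] is a line, the
    components of the collapsed forest are segments, and their stabilizers are
    elliptic, which contradicts the choice of the collapse.

    Colour a vertex [u] of [T] by the side of [e] that contains [f u]. As the
    stabilizer of [e] is commensurable to the vertex groups of [T] and [T] has
    finitely many orbits of edges, the edges of [T] whose ends have different
    colours stay at bounded distance from any vertex ([coboundary_bounded]).
    Each end of [T] therefore has a colour, both colours occur, and there is a
    vertex [v] at which every edge, except perhaps one mixed edge [p], has beyond
    it ends of a single colour, both colours being present
    ([bicoloured_vertex]). In the Whitehead graph at [v], an edge of one colour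
    is never adjacent to an edge of the other colour ([wh_adj_colour]). So the
    graph is disconnected or [p] is a cut point, and it remains to see that one
    of the cuts is admissible.

    For [k] in the stabilizer of [v], which is elliptic in [S], either [k] fixes
    [e], or [e] and its translate have disjoint sides of one colour
    ([elliptic_trichotomy]); only one colour can occur in this way when [k]
    varies ([disjoint_sides_exclusive]). The other colour is good: an element of
    the stabilizer of [v] taking an edge of the good colour to another one fixes
    [e], and thus lies in a group of the family, while no translate of [p] has
    the good colour. If some component of the Whitehead graph has only edges of
    the good colour, it is admissible. Otherwise all these edges lie in the
    component of [p]; that component is admissible if it has no edge of the other
    colour, and if it has one then [p] is an admissible cut point. *)

Set Implicit Arguments.
Unset Strict Implicit.
Unset Printing Implicit Defensive.

Local Open Scope classical_set_scope.

(** * Paths, distances and half-trees in a tree *)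

Section Paths.
Variable X : sgraph.
Implicit Types (u v w : vert X) (e : edge X) (s : seq (edge X)).

Lemma term_rev e : term (erev e) = org e.
Proof. by rewrite /term erev_involutive. Qed.

Lemma org_rev e : org (erev e) = term e.
Proof. by []. Qed.

Lemma erev_inj e e' : erev e = erev e' -> e = e'.
Proof. by move=> /(congr1 (@erev X)); rewrite !erev_involutive. Qed.

Lemma epath_cat F u s1 w s2 v :
  @epath X F u s1 w -> epath F w s2 v -> epath F u (s1 ++ s2) v.
Proof.
by elim: s1 u => [|e s1 IH] u /=; [move=> ->|move=> [Fe oe p1] p2; split=> //; exact: IH].
Qed.

Lemma epath_catE F u s1 s2 v :
  @epath X F u (s1 ++ s2) v -> exists2 w, epath F u s1 w & epath F w s2 v.
Proof.
elim: s1 u => [|e s1 IH] u /=; first by exists u.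
by move=> [Fe oe /IH[w p1 p2]]; exists w.
Qed.

Lemma epath_sub (F F' : set (edge X)) u s v :
  F `<=` F' -> epath F u s v -> epath F' u s v.
Proof.
by move=> sF; elim: s u => //= e s IH u [Fe oe /IH p]; split=> //; exact: sF.
Qed.

Lemma epath_rev (F : set (edge X)) u s v : (forall e, F e -> F (erev e)) ->
  epath F u s v -> epath F v (rev (map (@erev X) s)) u.
Proof.
move=> symF; elim: s u => [|e s IH] u /=; first by move=> ->.
move=> [Fe oe /IH p]; rewrite rev_cons -cats1; apply: epath_cat p _ => /=.
by rewrite term_rev; split=> //; exact: symF.
Qed.

Lemma epath_In (F : set (edge X)) u s v :
  epath F u s v -> epath [set e | List.In e s] u s v.
Proof.
elim: s u => //= e s IH u [Fe oe /IH p]; split=> //; first by left.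
by apply: epath_sub p => c /= ?; right.
Qed.

Lemma nb_cons e s : no_backtrack (e :: s) -> no_backtrack s.
Proof. by case. Qed.

Lemma nb_cat s1 s2 : no_backtrack s1 -> no_backtrack s2 ->
  (forall t1 e e' t2, s1 = rcons t1 e -> s2 = e' :: t2 -> e' <> erev e) ->
  no_backtrack (s1 ++ s2).
Proof.
elim: s1 => [//|e s1 IH] nb1 nb2 jn; rewrite cat_cons.
have nb12 : no_backtrack (s1 ++ s2).
  apply: IH => //; first exact: nb_cons nb1.
  by move=> t1 b b' t2 E1 E2; apply: (jn (e :: t1) b b' t2) => //; rewrite E1.
split=> //; case: s1 nb1 jn {IH nb12} => [|b s1] [nb1 _] jn //=.
by case: s2 jn {nb2} => // b s2 jn; apply: (jn [::] e b s2).
Qed.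

Lemma nb_rcons s e e' : no_backtrack (rcons (rcons s e) e') -> e' <> erev e.
Proof. by elim: s => [[]//|b s IH] /= [_ /IH]. Qed.

Lemma nb_belast s e : no_backtrack (rcons s e) -> no_backtrack s.
Proof.
elim: s => //= b s IH [h /IH nb]; split=> //.
by case: s h {IH nb}.
Qed.

Lemma nb_rev s : no_backtrack s -> no_backtrack (rev (map (@erev X) s)).
Proof.
elim/last_ind: s => [//|s e IH] nb; rewrite map_rcons rev_rcons.
split; last exact/IH/(nb_belast nb).
case/lastP: s nb {IH} => [//|s b] nb; rewrite map_rcons rev_rcons => E.
by apply: (nb_rcons nb); rewrite (erev_inj E) erev_involutive.
Qed.

Lemma shorten_backtrack F u s v : epath F u s v -> ~ no_backtrack s ->
  exists2 s', epath F u s' v & size s' < size s.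
Proof.
elim: s u => [u _ []//|e s IH] u [Fe oe p] nnb.
have [nb|nnb'] := pselect (no_backtrack s); last first.
  have [s' p' lt] := IH _ p nnb'; exists (e :: s') => //=.
case: s p nb nnb {IH} => [|b s] p nb nnb; first by case: nnb.
have [E|nE] := pselect (b = erev e); last by case: nnb.
exists s; last by rewrite /= ltnW.
by move: p => /= [_ _]; rewrite E term_rev oe.
Qed.

End Paths.

Section Dist.
Variable X : sgraph.
Hypothesis treeX : is_tree X.
Implicit Types (u v w : vert X) (e a b c : edge X) (s : seq (edge X)).

Let conX u v : exists s, epath [set: edge X] u s v.
Proof. by case: treeX => _ _ /(_ u v). Qed.

(** Two reduced paths that differ at their first edge close up to a nontrivial
    reduced loop. *)
Lemma reduced_path_unique u v s s' :
  epath [set: edge X] u s v -> epath [set: edge X] u s' v ->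
  no_backtrack s -> no_backtrack s' -> s = s'.
Proof.
have [_ _ _ noloop] := treeX.
elim: s u s' => [|e s IH] u [|e' s'] //.
- by move=> E p _ nb; rewrite [u]E in p; rewrite (noloop _ _ p nb).
- by move=> p E nb _; rewrite [u]E in p; rewrite (noloop _ _ p nb).
move=> p p' nb nb'; have [E|nE] := pselect (e = e').
  rewrite -{}E in p' nb' *; congr cons; move: p p' => [_ _ p] [_ _ p'].
  by apply: IH p p' _ _; [exact: nb_cons nb|exact: nb_cons nb'].
have p2 : epath [set: edge X] v (rev (map (@erev X) (e' :: s')) ++ e :: s) v.
  by apply: epath_cat p; apply: epath_rev p'.
have nb2 : no_backtrack (rev (map (@erev X) (e' :: s')) ++ e :: s).
  apply: nb_cat => //; first exact: nb_rev.
  move=> t1 b b' t2; rewrite /= rev_cons => /rcons_inj[_ <-] [<- _] E.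
  by apply: nE; rewrite E erev_involutive.
have /(congr1 size) := noloop _ _ p2 nb2.
by rewrite size_cat /= addnS.
Qed.

Let dist_ex u v :
  exists n, `[< exists2 s, epath [set: edge X] u s v & size s = n >].
Proof. by have [s p] := conX u v; exists (size s); apply/asboolP; exists s. Qed.

Definition dist u v : nat := ex_minn (dist_ex u v).

Lemma dist_path u v : exists2 s, epath [set: edge X] u s v & size s = dist u v.
Proof. by rewrite /dist; case: ex_minnP => n /asboolP. Qed.

Lemma dist_le u s v : epath [set: edge X] u s v -> dist u v <= size s.
Proof.
by move=> p; rewrite /dist; case: ex_minnP => n _ -> //; apply/asboolP; exists s.
Qed.

Lemma distxx u : dist u u = 0.
Proof. by apply/eqP; rewrite -leqn0; apply: (@dist_le u [::] u). Qed.

Lemma dist_eq0 u v : dist u v = 0 -> u = v.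
Proof. by have [[|a s] p <-] := dist_path u v. Qed.

Let dist_symle u v : dist u v <= dist v u.
Proof.
have [s p <-] := dist_path v u; rewrite -(size_map (@erev X)) -size_rev.
by apply: dist_le; apply: epath_rev p.
Qed.

Lemma distC u v : dist u v = dist v u.
Proof. by apply/eqP; rewrite eqn_leq !dist_symle. Qed.

Lemma dist_tri w u v : dist u v <= dist u w + dist w v.
Proof.
have [s p <-] := dist_path u w; have [s' p' <-] := dist_path w v.
by rewrite -size_cat; apply: dist_le; apply: epath_cat p p'.
Qed.

Lemma shortest_reduced u s v : epath [set: edge X] u s v ->
  size s = dist u v -> no_backtrack s.
Proof.
move=> p E; apply: contrapT => /(shorten_backtrack p)[s' /dist_le].
by rewrite E leqNgt => /negP.
Qed.

Lemma reduced_shortest u s v : epath [set: edge X] u s v ->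
  no_backtrack s -> size s = dist u v.
Proof.
move=> p nb; have [s' p' E] := dist_path u v; rewrite -E.
by rewrite (reduced_path_unique p p' nb (shortest_reduced p' E)).
Qed.

(** A shortest path from [term e] either starts by crossing [e] backwards, or
    remains reduced, hence shortest, when [e] is put in front of it. *)
Lemma dist_edge e u :
  dist (org e) u = (dist (term e) u).+1 \/ dist (term e) u = (dist (org e) u).+1.
Proof.
have [s p E] := dist_path (term e) u.
have nb := shortest_reduced p E.
have [[t E']|nstart] := pselect (exists t, s = erev e :: t).
  right; rewrite -E E' /=; congr S.
  move: p nb; rewrite E' => -[_ _]; rewrite term_rev => p [_ nb].
  by rewrite (reduced_shortest p).
left; rewrite -E -(@reduced_shortest _ (e :: s) u) //=; split=> //.
by case: s nstart {p E nb} => // b s nstart E; apply: nstart; exists s; rewrite E.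
Qed.

Lemma edge_toward u v : u <> v ->
  exists2 a, org a = u & dist u v = (dist (term a) v).+1.
Proof.
move=> nuv; have [[|a s] p E] := dist_path u v; first by [].
exists a; first by case: p.
have /nb_cons nb := shortest_reduced p E; case: p => _ _ p.
by rewrite -E /= (reduced_shortest p nb).
Qed.

Lemma edge_toward_unique a b v : org a = org b ->
  dist (org a) v = (dist (term a) v).+1 -> dist (org b) v = (dist (term b) v).+1 ->
  a = b.
Proof.
move=> E da db; have [s p Es] := dist_path (term a) v.
have [s' p' Es'] := dist_path (term b) v.
have pa : epath [set: edge X] (org a) (a :: s) v by [].
have pb : epath [set: edge X] (org a) (b :: s') v by rewrite E.
have ra : no_backtrack (a :: s) by apply: (shortest_reduced pa); rewrite /= Es da.
have rb : no_backtrack (b :: s').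
  by apply: (shortest_reduced pb); rewrite /= Es' E db.
by have [] := reduced_path_unique pa pb ra rb.
Qed.

(** The part of the tree beyond [e]. It is boolean so that the reversed edge
    gives the negated predicate, and a pair of opposite half-trees is a
    two-colouring of the vertices. *)
Definition halftree e u : bool := dist (term e) u < dist (org e) u.

Lemma half_rev e u : halftree (erev e) u = ~~ halftree e u.
Proof. by rewrite /halftree term_rev /=; have := dist_edge e u; rewrite /term; lia. Qed.

Lemma half_term e : halftree e (term e).
Proof. by rewrite /halftree distxx; have := dist_edge e (term e); rewrite distxx; lia. Qed.

Lemma half_org e : halftree e (org e) = false.
Proof. by have := half_term (erev e); rewrite half_rev term_rev; case: halftree. Qed.

Lemma dist_halfT e u : halftree e u -> dist (org e) u = (dist (term e) u).+1.
Proof. by rewrite /halftree; have := dist_edge e u; lia. Qed.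

Lemma dist_halfF e u : halftree e u = false -> dist (term e) u = (dist (org e) u).+1.
Proof. by rewrite /halftree; have := dist_edge e u; lia. Qed.

Lemma dist_org_term e : dist (org e) (term e) = 1.
Proof. by rewrite (dist_halfT (half_term e)) distxx. Qed.

Lemma half_unique a b u : org a = org b -> halftree a u -> halftree b u -> a = b.
Proof. by move=> E /dist_halfT da /dist_halfT db; apply: edge_toward_unique E da db. Qed.

Lemma edge_toward_half u v : u <> v -> exists2 a, org a = u & halftree a v.
Proof. by move=> /edge_toward[a oa d]; exists a; rewrite // /halftree oa d. Qed.

(* If another edge [b] left [halftree c], then [b] and the first edge of a path
   from [org b] to [term c] would both lead from [org b] towards [org c]. *)
Let half_step_aux c b : b <> erev c -> halftree c (org b) -> halftree c (term b).
Proof.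
move=> nb h1; apply: contrapT => /negP/negbTE h2.
have := dist_halfT h1; have := dist_halfF h2.
move Ek : (dist (term c) (org b)) => k e2 e1.
have d1 := dist_org_term b.
have Eo : dist (org c) (term b) = k.
  have := dist_tri (term b) (org c) (org b); have := dist_tri (org b) (term c) (term b).
  by rewrite (distC (term b) (org b)); lia.
case: k Ek e1 Eo => [|k] Ek e1 Eo.
  apply: nb; apply: (@edge_toward_unique _ _ (org c)); first by rewrite org_rev (dist_eq0 Ek).
    by rewrite 2!(distC _ (org c)) e1 Eo.
  by rewrite org_rev term_rev distxx distC dist_org_term.
have nE : org b <> term c by move=> E; rewrite E distxx in Ek.
have [b1 o1] := edge_toward nE; rewrite !(distC _ (term c)) Ek => -[Ek1].
have E : b = b1.
  apply: (@edge_toward_unique _ _ (org c)) => //.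
    by rewrite 2!(distC _ (org c)) e1 Eo.
  have := dist_tri (term c) (org c) (term b1).
  have := dist_tri (term b1) (org c) (org b).
  have := dist_org_term b1; have := dist_org_term c.
  rewrite o1 (distC (term b1) (org b)) => d2 d3.
  by rewrite (distC (org b) (org c)) (distC (term b1) (org c)) e1; lia.
by rewrite -E e2 Eo in Ek1; lia.
Qed.

Lemma half_step c b : b <> c -> b <> erev c -> halftree c (org b) = halftree c (term b).
Proof.
move=> n1 n2; apply/idP/idP; first exact: half_step_aux.
have := @half_step_aux c (erev b); rewrite term_rev org_rev; apply.
by move/erev_inj.
Qed.

Lemma half_path c (F : set (edge X)) u s v :
  ~ F c -> ~ F (erev c) -> epath F u s v -> halftree c u = halftree c v.
Proof.
move=> n1 n2; elim: s u => [|b s IH] u /=; first by move=> ->.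
move=> [Fb <- /IH <-]; apply: half_step => E; rewrite E in Fb; contradiction.
Qed.

Lemma half_follow c b : org b = term c -> b <> erev c ->
  forall u, halftree b u -> halftree c u.
Proof.
move=> E nb u hb; apply: contrapT => /negP hc; apply: nb.
by apply: half_unique hb _; rewrite ?half_rev.
Qed.

(** Induction along the path to [term c], which stays in [halftree c]. *)
Lemma half_ind c (P : vert X -> Prop) : P (term c) ->
  (forall b, halftree c (org b) -> halftree c (term b) ->
     dist (org b) (term c) = (dist (term b) (term c)).+1 -> P (term b) -> P (org b)) ->
  forall u, halftree c u -> P u.
Proof.
move=> P0 PS u; move Ek : (dist u (term c)) => k.
elim: k u Ek => [|k IH] u Ek hu; first by rewrite (dist_eq0 Ek).
have nE : u <> term c by move=> E; rewrite E distxx in Ek.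
have [b ob db] := edge_toward nE.
have hb : halftree c (term b).
  rewrite -(@half_step c b) ?ob //.
    by move=> E; rewrite -ob E half_org in hu.
  by move=> E; apply: nE; rewrite -ob E.
by rewrite -ob; apply: PS; rewrite ?ob //; apply: IH; rewrite // Ek in db; case: db.
Qed.

Lemma cross c u z : halftree c u -> halftree c z = false ->
  dist u z = (dist u (term c) + dist (org c) z).+1.
Proof.
move=> hu hz; apply/eqP; rewrite eqn_leq; apply/andP; split.
  have := dist_tri (term c) u z; have := dist_tri (org c) (term c) z.
  by have := dist_org_term c; rewrite (distC (org c) (term c)); lia.
move Ek : (dist u z) => k; elim: k u hu Ek => [|k IH] u hu Ek.
  by move: hu; rewrite (dist_eq0 Ek) hz.
have nE : u <> z by move=> E; rewrite E distxx in Ek.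
have [b ob db] := edge_toward nE; rewrite Ek in db.
have [Eb|nb] := pselect (b = erev c).
  rewrite -ob Eb org_rev distxx; move: db; rewrite Eb term_rev; lia.
have nb' : b <> c by move=> E; rewrite -ob E half_org in hu.
have hb : halftree c (term b) by rewrite -(half_step nb' nb) ob.
have := IH _ hb; have := dist_tri (term b) u (term c); have := dist_org_term b.
by rewrite ob; lia.
Qed.

(* The path to [term c] stays in [halftree c], hence does not cross [c']. *)
Lemma half_const c c' : halftree c (org c') = false -> halftree c (term c') = false ->
  forall u, halftree c u -> halftree c' u = halftree c' (term c).
Proof.
move=> h1 h2; apply: half_ind => // b hb1 hb2 _ <-; apply: half_step => E.
  by rewrite E h1 in hb1.
by rewrite E org_rev h2 in hb1.
Qed.

(** Two edges cut the tree into at most three pieces. *)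
Lemma half_nested c c' : c' <> c -> c' <> erev c ->
  [\/ (forall u, halftree c' u -> halftree c u -> False),
      (forall u, halftree c' u = false -> halftree c u = false -> False),
      (forall u, halftree c' u -> halftree c u) | (forall u, halftree c u -> halftree c' u)].
Proof.
move=> n1 n2.
have st : halftree c (org c') = halftree c (term c') by apply: half_step.
have st' : halftree c' (org c) = halftree c' (term c).
  by apply: half_step => E; [apply: n1|apply: n2; rewrite E erev_involutive].
case Ec : (halftree c (org c')); case Ec' : (halftree c' (org c)).
- constructor 2 => u h1 h2.
  have := @half_const (erev c) c'; rewrite !half_rev -st Ec => /(_ erefl erefl u).
  by rewrite half_rev h2 term_rev Ec' h1 => /(_ erefl).
- constructor 3 => u h1; apply/negP => /negP h2.
  have := @half_const (erev c) c'; rewrite !half_rev -st Ec => /(_ erefl erefl u).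
  by rewrite half_rev h2 term_rev Ec' h1 => /(_ erefl).
- constructor 4 => u h1.
  by have := @half_const c c'; rewrite -st Ec => /(_ erefl erefl u h1) ->; rewrite -st'.
- constructor 1 => u h1 h2.
  have := @half_const c c'; rewrite -st Ec => /(_ erefl erefl u h2).
  by rewrite -st' Ec' h1.
Qed.

Lemma half_inj c c' : halftree c =1 halftree c' -> c = c'.
Proof.
move=> E; apply: contrapT => n1.
have [E'|n2] := pselect (c = erev c').
  by have := E (term c); rewrite half_term E' term_rev half_org.
have := @half_step c' c n1 n2.
by rewrite -!E half_org half_term.
Qed.

(** Edges separating two vertices lie on any path between them. *)
Lemma separating_finite u v :
  exists s, forall c, halftree c u <> halftree c v -> List.In c s.
Proof.
have [s p] := conX u v; exists (s ++ map (@erev X) s) => c ne.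
apply: contrapT => nin; apply: ne.
apply: (@half_path c [set b | List.In b s] u s v); last exact: epath_In p.
  by move=> h; apply: nin; apply/List.in_or_app; left.
move=> h; apply: nin; apply/List.in_or_app; right.
by rewrite -(erev_involutive c); apply: (List.in_map (@erev X)).
Qed.

End Dist.

(** * Trees with a minimal action *)

Notation tdist := (dist (gtree_tree _)).
Notation thalf := (halftree (gtree_tree _)).

Section Connected.
Variables (X : sgraph) (F : set (edge X)).
Hypothesis symF : forall e, F e -> F (erev e).

Lemma connected_in_trans v u w :
  connected_in F u v -> connected_in F v w -> connected_in F u w.
Proof. by move=> [s p] [s' p']; exists (s ++ s'); apply: epath_cat p p'. Qed.

Lemma connected_in_sym u v : connected_in F u v -> connected_in F v u.
Proof. by move=> [s p]; eexists; exact: epath_rev symF p. Qed.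

Lemma connected_in_edge e : F e -> connected_in F (org e) (term e).
Proof. by move=> Fe; exists [:: e]; split. Qed.

Lemma connected_in_path u s v : epath F u s v ->
  forall c, List.In c s -> connected_in F u (org c).
Proof.
elim: s u => //= e s IH u [Fe oe p] c [<-|/(IH _ p) h].
  by rewrite oe; exists [::].
by apply: connected_in_trans h; rewrite -oe; exact: connected_in_edge.
Qed.

End Connected.

Section GTrees.
Variables (G : groupType) (T : gtree G).
Implicit Types (g h k : G) (u v w y : vert T) (a b c e : edge T).
Local Open Scope group_scope.

Lemma vactK g v : vact g^-1 (vact g v) = v.
Proof. by rewrite -vactM mulVg vact1. Qed.

Lemma vactVK g v : vact g (vact g^-1 v) = v.
Proof. by rewrite -vactM mulgV vact1. Qed.

Lemma eactK g e : eact g^-1 (eact g e) = e.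
Proof. by rewrite -eactM mulVg eact1. Qed.

Lemma eactVK g e : eact g (eact g^-1 e) = e.
Proof. by rewrite -eactM mulgV eact1. Qed.

Lemma vact_inj g : injective (@vact G T g).
Proof. exact: can_inj (vactK g). Qed.

Lemma eact_inj g : injective (@eact G T g).
Proof. exact: can_inj (eactK g). Qed.

Lemma act_term g e : term (eact g e) = vact g (term e).
Proof. by rewrite /term act_rev act_org. Qed.

Lemma epath_act (F : set (edge T)) g u s v : (forall c, F c -> F (eact g c)) ->
  epath F u s v -> epath F (vact g u) (map (eact g) s) (vact g v).
Proof.
move=> gF; elim: s u => [|e s IH] u /=; first by move=> ->.
move=> [Fe oe p]; split; [exact: gF|by rewrite act_org oe|].
by rewrite act_term; exact: IH.
Qed.

Lemma connected_in_act (F : set (edge T)) g u v : (forall c, F c -> F (eact g c)) ->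
  connected_in F u v -> connected_in F (vact g u) (vact g v).
Proof. by move=> gF [s p]; eexists; exact: epath_act gF p. Qed.

Lemma dist_act g u v : tdist (vact g u) (vact g v) = tdist u v.
Proof.
have le h x y : tdist (vact h x) (vact h y) <= tdist x y.
  have [s p <-] := dist_path (gtree_tree T) x y.
  by rewrite -(size_map (eact h)); apply: dist_le; apply: epath_act p.
by apply/eqP; rewrite eqn_leq le /= -{1}(vactK g u) -{1}(vactK g v) le.
Qed.

Lemma half_act g e u : thalf (eact g e) (vact g u) = thalf e u.
Proof. by rewrite /halftree act_term act_org !dist_act. Qed.

Lemma half_actV g e u : thalf (eact g e) u = thalf e (vact g^-1 u).
Proof. by rewrite -{1}(vactVK g u) half_act. Qed.

(** The union of the paths between points of an orbit is an invariant subtree,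
    hence contains [e] by minimality. *)
Lemma orbit_meets_half y e : exists g, thalf e (vact g y).
Proof.
pose F : set (edge T) :=
  [set c | exists g h, thalf c (vact g y) /\ thalf c (vact h y) = false].
have symF c : F c -> F (erev c).
  by move=> [g [h [hg hh]]]; exists h, g; rewrite !half_rev hg hh.
have gF g c : F c -> F (eact g c).
  move=> [h [h' [c1 c2]]]; exists (g * h), (g * h').
  by rewrite !vactM !half_act.
have con g h : connected_in F (vact g y) (vact h y).
  have [s p E] := dist_path (gtree_tree T) (vact g y) (vact h y).
  exists s; suff H : forall s u, epath [set: edge T] u s (vact h y) ->
      size s = tdist u (vact h y) ->
      (forall c, thalf c u -> thalf c (vact h y) = false -> thalf c (vact g y)) ->
      epath F u s (vact h y) by apply: H.
  elim=> [//|b t IH] u /= [_ ob pt] Et D {p E s}.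
  have hb : thalf b (vact h y).
    by rewrite /halftree ob -Et ltnS; exact: dist_le pt.
  have Etl : size t = tdist (term b) (vact h y).
    by have := dist_halfT hb; rewrite ob -Et => -[].
  split=> //.
    exists h, g; split=> //; apply/negbTE/negP => h1.
    have := D (erev b); rewrite !half_rev -ob half_org hb h1.
    by move=> /(_ erefl erefl).
  apply: IH => // c hc hc'; apply: D => //; rewrite -ob.
  have [E|nE] := pselect (b = c); first by rewrite E hc' in hb.
  have [E'|nE'] := pselect (b = erev c); last by rewrite (half_step _ nE nE').
  by rewrite E' org_rev half_term.
pose W : set (vert T) := [set u | connected_in F y u].
have Wy : W y by exists [::].
have Wg g : W (vact g y) by rewrite /W /= -{1}(vact1 y).
have [|||||_ FT] := @gtree_minimal G T W F; first by exists y.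
- move=> c Fc; split; last exact: symF.
  have [g [h [hg hh]]] := Fc; have [s p] := con h g.
  have [nF|] := pselect (List.In c s \/ List.In (erev c) s); last first.
    move=> nin; have := @half_path _ (gtree_tree T) c _ _ _ _ _ _ (epath_In p).
    by rewrite hg hh /= => E; have := E (fun x => nin (or_introl x))
      (fun x => nin (or_intror x)).
  case: nF => /(connected_in_path p) h1.
    by apply: connected_in_trans h1; exact: Wg.
  apply: connected_in_trans (connected_in_trans h1 _); first exact: Wg.
  rewrite org_rev; apply: connected_in_sym => //; exact: connected_in_edge.
- move=> u v Wu Wv; apply: connected_in_trans Wv; exact: connected_in_sym.
- move=> g v Wv; apply: (connected_in_trans (Wg g)).
  exact: (connected_in_act (gF g) Wv).
- exact: gF.
by have [g [_ [hg _]]] : F e by [rewrite FT]; exists g.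
Qed.

(* Otherwise the only translates of [org e] beyond [e] would be [term e], and
   such a translation would map [e] to its reverse. *)
Lemma no_leaf e : exists2 b, org b = term e & b <> erev e.
Proof.
have [g hg] := orbit_meets_half (org e) e.
have [E|nE] := pselect (vact g (org e) = term e).
  by exists (eact g e); [rewrite act_org|exact: no_inversion].
have [b ob hb] := edge_toward_half (gtree_tree T) (nesym nE).
by exists b => // E; rewrite E half_rev hg in hb.
Qed.

Lemma half_deep e n : exists c,
  (forall u, thalf c u -> thalf e u) /\ (forall u, thalf c u -> n < tdist (org e) u).
Proof.
suff [c [c1 c2 c3]] : exists c, [/\ forall u, thalf c u -> thalf e u,
    thalf c (org e) = false & n <= tdist (org e) (org c)].
  exists c; split=> // u hu.
  by rewrite distC (cross hu c2) ltnS (distC _ (org c)); apply: leq_trans c3 (leq_addl _ _).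
elim: n => [|n [c [c1 c2 c3]]]; first by exists e; rewrite half_org.
have [b ob nb] := no_leaf c; exists b.
have s := half_follow (treeX := gtree_tree T) ob nb; split.
- by move=> u /s/c1.
- by apply/negP => /s; rewrite c2.
- by rewrite ob distC (dist_halfF c2) ltnS distC.
Qed.

(** Two distinct centres of [Y] are adjacent, and exchanging them would be an
    inversion. *)
Lemma bounded_fixed_vertex (K : set G) (Y : set (vert T)) y0 N :
  (forall k, K k -> K k^-1) -> Y y0 -> (forall y, Y y -> tdist y0 y <= N) ->
  (forall k y, K k -> Y y -> Y (vact k y)) ->
  exists v, forall k, K k -> vact k v = v.
Proof.
move=> KV Yy0 bd KY.
pose C n u := forall y, Y y -> tdist u y <= n.
have exC : exists n, `[< exists u, C n u >] by exists N; apply/asboolP; exists y0.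
case: (ex_minnP exC) => R /asboolP[u Cu] minR; exists u => k Kk.
have Cact x : C R x -> C R (vact k x).
  by move=> Cx y Yy; rewrite -(vactVK k y) dist_act; apply: Cx; apply: KY => //; exact: KV.
(* The neighbour of a centre towards another centre is strictly closer to all
   of [Y], unless it is that other centre. *)
have adj x x' : C R x -> C R x' -> x <> x' -> tdist x x' = 1%N.
  move=> Cx Cx' ne; have [a oa ha] := edge_toward_half (gtree_tree T) ne.
  have [E|nE] := pselect (term a = x'); first by rewrite -oa -E dist_org_term.
  have [b ob hb] := edge_toward_half (gtree_tree T) nE.
  have nb : b <> erev a by move=> E; rewrite E half_rev ha in hb.
  have C1 : C R.-1 (term a).
    move=> y Yy; case hy : (thalf a y).
      by have := Cx y Yy; rewrite -oa (dist_halfT hy); lia.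
    have hy' : thalf b y = false by apply/negP => /(half_follow ob nb); rewrite hy.
    by have := Cx' y Yy; rewrite (cross hb hy') ob; lia.
  have R0 : 0 < R.
    rewrite lt0n; apply/eqP => R0; apply: ne.
    have /eqP/dist_eq0-> : tdist x y0 == 0 by rewrite -leqn0 -R0; exact: Cx.
    by have /eqP/dist_eq0-> : tdist x' y0 == 0 by rewrite -leqn0 -R0; exact: Cx'.
  suff : R <= R.-1 by lia.
  by apply: minR; apply/asboolP; exists (term a).
apply: contrapT => nk.
have Cu' := Cact _ Cu; have Cu'' := Cact _ Cu'.
have [a oa ta] : exists2 a, org a = u & term a = vact k u.
  have [a oa ha] := edge_toward_half (gtree_tree T) (nesym nk); exists a => //.
  have := dist_halfT ha; rewrite oa adj //; last exact: nesym.
  by case=> /esym/dist_eq0.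
have kk : vact k (vact k u) = u.
  apply: contrapT => n1; have n2 : vact k (vact k u) <> vact k u.
    by move=> /vact_inj.
  by have := dist_edge (gtree_tree T) a (vact k (vact k u));
    rewrite oa ta !adj //; [case|exact: nesym|exact: nesym].
apply: (@no_inversion G T k a); apply: (@half_unique _ (gtree_tree T) _ _ u).
- by rewrite act_org oa org_rev ta.
- by rewrite -kk -ta -act_term half_term.
- by rewrite -oa -term_rev half_term.
Qed.

(** The translates of paths from a vertex to its images under the generators form
    an invariant subtree. *)
Lemma finitely_many_edge_orbits (gs : seq G) :
  generates [set g | List.In g gs] ->
  exists cs : seq (edge T), forall c, exists g, exists2 c0, List.In c0 cs & c = eact g c0.
Proof.
move=> gen; have [[o] _ con _] := gtree_tree T.
pose p g := sval (cid (con o (vact g o))).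
have pP g : epath [set: edge T] o (p g) (vact g o) by rewrite /p; case: cid.
pose cs := flatten (map p gs).
pose cs' := cs ++ map (@erev T) cs.
have in_cs g c : List.In g gs -> List.In c (p g) -> List.In c cs.
  rewrite /cs; elim: gs {gen cs cs'} => //= h gs IH.
  by move=> [->|hg] cp; apply/List.in_app_iff; [left|right; exact: IH].
have cs_in c : List.In c cs -> exists2 g, List.In g gs & List.In c (p g).
  rewrite /cs; elim: gs {gen cs cs' in_cs} => //= h gs IH /List.in_app_iff[cp|/IH[g hg cp]].
    by exists h => //; left.
  by exists g => //; right.
pose F : set (edge T) := [set c | exists g, exists2 c0, List.In c0 cs' & c = eact g c0].
have symF c : F c -> F (erev c).
  move=> [g [c0 /List.in_app_iff c0cs ->]]; exists g, (erev c0); last by rewrite act_rev.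
  apply/List.in_app_iff; case: c0cs => h; [right; exact: List.in_map|left].
  by move/List.in_map_iff: h => [b [<- h]]; rewrite erev_involutive.
have gF g c : F c -> F (eact g c).
  by move=> [h [c0 ? ->]]; exists (g * h), c0 => //; rewrite eactM.
have Fcs c : List.In c cs -> F c.
  by move=> h; exists 1, c; rewrite ?eact1 //; apply/List.in_app_iff; left.
have pF g : List.In g gs -> epath F o (p g) (vact g o).
  move=> hg; apply: epath_sub (epath_In (pP g)) => c /= cp.
  exact: Fcs (in_cs g c hg cp).
pose W := [set u | connected_in F o u].
have FW g : List.In g gs -> W (vact g o) by move=> /pF; exists (p g).
have Wtrans g u : W (vact g o) -> W u -> W (vact g u).
  by move=> h1 Wu; apply: (connected_in_trans h1); exact: (connected_in_act (gF g) Wu).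
have subW : is_subgroup [set g | W (vact g o)].
  split; first by exists [::] => /=; rewrite vact1.
    by move=> g h Wg Wh /=; rewrite vactM; exact: Wtrans.
  move=> g Wg /=; have := connected_in_act (gF g^-1) Wg.
  by rewrite vactK => /(connected_in_sym symF).
have Wg g : W (vact g o) by have := gen _ subW FW; move/seteqP => [_ /(_ g)]; exact.
have Wcs c : List.In c cs -> W (org c).
  by move=> /cs_in[g gg cp]; exact: connected_in_path (pF g gg) _ cp.
have Wcs' c : List.In c cs' -> W (org c).
  move=> /List.in_app_iff[/Wcs//|/List.in_map_iff[b [<- bcs]]].
  rewrite org_rev; apply: (connected_in_trans (Wcs b bcs)).
  by apply: connected_in_edge; exact: Fcs.
have [|||||_ FT] := @gtree_minimal G T W F; first by exists o; exists [::].
- move=> c Fc; split; last exact: symF.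
  by have [g [c0 cc ->]] := Fc; rewrite act_org; apply: Wtrans => //; exact: Wcs'.
- by move=> u v Wu Wv; apply: connected_in_trans Wv; exact: connected_in_sym.
- by move=> g v Wv; exact: Wtrans.
- exact: gF.
by exists cs' => c; have : F c by rewrite FT.
Qed.

End GTrees.

Local Open Scope group_scope.

(** * Commensurable stabilizers and axes *)

Lemma int_succ_ind (P : int -> Prop) :
  P 0%R -> (forall m, P m <-> P (m + 1)%R) -> forall m, P m.
Proof.
move=> P0 PS; case=> k.
  elim: k => // k IH; have -> : Posz k.+1 = (Posz k + 1)%R by lia.
  exact/(PS (Posz k)).
elim: k => [|k IH]; apply/(PS (Negz _)); first by have -> : (Negz 0 + 1)%R = 0%R by lia.
by have -> : (Negz k.+1 + 1)%R = Negz k by lia.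
Qed.

Section Powers.
Variable G : groupType.
Implicit Types (a x : G) (m n : int).

Lemma expgz_succ a m : expgz a (m + 1)%R = expgz a m * a.
Proof.
case: m => [k|[|k]].
- have -> : (Posz k + 1)%R = Posz k.+1 by lia.
  by rewrite /= expgSr.
- have -> : (Negz 0 + 1)%R = 0%R by lia.
  by rewrite /= expg1 mulVg.
- have -> : (Negz k.+1 + 1)%R = Negz k by lia.
  by rewrite /= (expgS a k.+1) invgM mulgVK.
Qed.

Lemma expgzD a m n : expgz a (m + n)%R = expgz a m * expgz a n.
Proof.
move: n; apply: int_succ_ind => [|n]; first by rewrite GRing.addr0 mulg1.
rewrite GRing.addrA !expgz_succ mulgA; split=> [->//|].
exact: mulIg.
Qed.

Lemma expgzM a m n : expgz (expgz a m) n = expgz a (m * n)%R.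
Proof.
move: n; apply: int_succ_ind => [|n]; first by rewrite GRing.mulr0.
rewrite GRing.mulrDr GRing.mulr1 expgz_succ expgzD; split=> [->//|].
exact: mulIg.
Qed.

Lemma expgzN a m : expgz a (- m)%R = (expgz a m)^-1.
Proof.
by apply: (mulIg (expgz a m)); rewrite mulVg -expgzD GRing.addNr.
Qed.

Lemma subgroup_expgz (H : set G) a n : is_subgroup H -> H a -> H (expgz a n).
Proof.
move=> [H1 HM HV] Ha.
have HX k : H (a ^+ k) by elim: k => // k IH; rewrite expgS; exact: HM.
by case: n => k /=; [|apply: HV].
Qed.

End Powers.

Section Stabilizers.
Variables (G : groupType) (T : gtree G).
Implicit Types (g h : G) (u v : vert T) (e : edge T).

Lemma vstab_subgroup v : is_subgroup (vstab v).
Proof.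
split=> /=; first exact: vact1.
  by move=> x y xv yv; rewrite /vstab /= vactM yv.
by move=> x xv; rewrite /vstab /= -{1}xv vactK.
Qed.

Lemma estab_subgroup e : is_subgroup (estab e).
Proof.
split=> /=; first exact: eact1.
  by move=> x y xv yv; rewrite /estab /= eactM yv.
by move=> x xv; rewrite /estab /= -{1}xv eactK.
Qed.

Lemma estab_org e g : eact g e = e -> vact g (org e) = org e.
Proof. by rewrite -act_org => ->. Qed.

Lemma estab_term e g : eact g e = e -> vact g (term e) = term e.
Proof. by rewrite -act_term => ->. Qed.

Hypothesis TD : in_D T.

Lemma vstab_torsion_free v g n :
  vact g v = v -> 0 < n -> g ^+ n = 1 -> g = 1.
Proof.
move=> gv n0; have [a inja E] := TD.1 v.
have : vstab v g by []; rewrite E => -[i _ <-] /=.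
rewrite -[_ ^+ n]/(expgz _ (Posz n)) expgzM -[1]/(expgz a 0%R) => /inja.
by move=> E0; congr expgz; nia.
Qed.

(* An edge group is a nontrivial subgroup of an infinite cyclic vertex group. *)
Lemma vstab_power_estab g e :
  vact g (org e) = org e -> exists2 n, 0 < n & eact (g ^+ n) e = e.
Proof.
move=> ge; have [a inja Ea] := TD.1 (org e); have [b injb Eb] := TD.2 e.
have be : estab e b by rewrite Eb; exists 1%R; rewrite //= expg1.
have : vstab (org e) b by exact: estab_org.
rewrite Ea => -[k _ Ek].
have k0 : k <> 0%R.
  move=> E; have : (1 = 0 :> int)%R by apply: injb; rewrite /= expg1 -Ek E.
  by [].
have : vstab (org e) g by []; rewrite Ea => -[i _ Ei].
exists `|k|%N; first lia.
suff : estab e (g ^+ `|k|%N) by [].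
have sube := estab_subgroup e.
have := subgroup_expgz i sube be; rewrite -Ek expgzM => H.
rewrite -[_ ^+ _]/(expgz g (Posz `|k|%N)) -Ei expgzM.
have [->|->] : Posz `|k|%N = k \/ Posz `|k|%N = (- k)%R by lia.
  by rewrite GRing.mulrC.
rewrite GRing.mulrN expgzN GRing.mulrC; by case: sube => _ _ HV; exact: HV.
Qed.

(** Adjacent vertex groups are commensurable to the edge group between them. *)
Lemma vstab_power_vstab u v g :
  vact g u = u -> exists2 n, 0 < n & vact (g ^+ n) v = v.
Proof.
have [_ _ /(_ u v)[s p] _] := gtree_tree T; move: p.
elim: s u g => [|e s IH] u g /=; first by move=> -> gv; exists 1%N; rewrite ?expg1.
move=> [_ oe p] gu; rewrite -oe in gu.
have [n n0 /estab_term ne] := vstab_power_estab gu.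
have [m m0 me] := IH _ _ p ne; exists (n * m)%N; first by rewrite muln_gt0 n0.
by rewrite expgnA.
Qed.

Lemma vstab_power_edge u e g :
  vact g u = u -> exists2 n, 0 < n & eact (g ^+ n) e = e.
Proof.
move=> /(vstab_power_vstab (org e))[n n0 /vstab_power_estab[m m0 E]].
by exists (n * m)%N; rewrite ?muln_gt0 ?n0 // expgnA.
Qed.

(** The stabilizers of [v] and [vact h v] are commensurable. *)
Lemma conj_generator_power v t h : injective (expgz t) -> vstab v = range (expgz t) ->
  exists n (m : int), [/\ 0 < n, m <> 0%R & (h * t * h^-1) ^+ n = expgz t m].
Proof.
move=> injt Et.
have tv : vact t v = v.
  by have : vstab v t by rewrite Et; exists 1%R; rewrite //= expg1.
have hv : vact (h * t * h^-1) (vact h v) = vact h v by rewrite -vactM mulgVK vactM tv.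
have [n n0] := vstab_power_vstab v hv.
move=> nv; have : vstab v ((h * t * h^-1) ^+ n) by [].
rewrite Et => -[m _ Em]; exists n, m; split=> // E0.
have := vstab_torsion_free hv n0; rewrite -Em E0 => /(_ erefl) E.
have t1 : t = 1.
  move/(congr1 (fun z => h^-1 * z * h)): E.
  by rewrite mulg1 mulVg !mulgA mulVg mul1g mulgVK.
by have : (1 = 0 :> int)%R by apply: injt; rewrite /= expg1 t1.
Qed.

End Stabilizers.

Lemma GBS_finitely_generated (G : groupType) : is_GBS G ->
  exists gs : seq G, generates [set g | List.In g gs].
Proof.
move=> [Gam [vZ eZ [Th _ [f [[fM _ _] gen _]]]]].
have genv (v : gvert Gam) : exists a : vgrp v, [set: vgrp v] = range (expgz a).
  by have [a _ E] := vZ v; exists a.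
pose a (v : gvert Gam) := sval (cid (genv v)).
have aP (v : gvert Gam) : [set: vgrp v] = range (expgz (a v)) by rewrite /a; case: cid.
pose gs := map (fun v => f (@vgen Gam v (a v))) (enum (gvert Gam)) ++
           map (fun e => f (@egen Gam e)) (enum (gedge Gam)).
have memIn (X : eqType) (x : X) (s : seq X) : x \in s -> List.In x s.
  elim: s => //= y s IH; rewrite inE => /orP[/eqP->|/IH]; first by left.
  by right.
exists gs => H sH gsH; apply: gen => // _ [[[v x]|e] _ <-]; last first.
  apply: gsH; apply/List.in_app_iff; right.
  by apply: (List.in_map (fun e => f (@egen Gam e))); apply: memIn; rewrite mem_enum.
have : [set: vgrp v] x by []; rewrite aP => -[i _ <-].
have fv1 : f (@vgen Gam v 1) = 1.
  by apply: (mulIg (f (@vgen Gam v 1))); rewrite -fM !mul1g.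
have -> : f (inl (existT _ v (expgz (a v) i))) = expgz (f (@vgen Gam v (a v))) i.
  rewrite -/(@vgen Gam v _); move: i; apply: int_succ_ind => [//|i].
  by rewrite !expgz_succ fM; split=> [->//|]; exact: mulIg.
apply: subgroup_expgz => //; apply: gsH; apply/List.in_app_iff; left.
by apply: (List.in_map (fun v => f (@vgen Gam v (a v)))); apply: memIn; rewrite mem_enum.
Qed.

Section BiInfinitePaths.
Variables (X : sgraph) (treeX : is_tree X) (p : int -> edge X).
Hypothesis p_org : forall i, org (p (i + 1)%R) = term (p i).
Hypothesis p_red : forall i, p (i + 1)%R <> erev (p i).
Implicit Types (i j : int).

Lemma line_half i j : halftree treeX (p i) (org (p j)) = (i < j)%R.
Proof.
have fwd n k : halftree treeX (p k) (org (p (k + 1 + Posz n)%R)).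
  elim: n k => [|n IH] k; first by rewrite GRing.addr0 p_org half_term.
  apply: (half_follow (p_org k) (@p_red k)).
  by have -> : (k + 1 + Posz n.+1 = k + 1 + 1 + Posz n)%R by lia.
have bwd n k : halftree treeX (erev (p k)) (org (p (k - Posz n)%R)).
  elim: n k => [|n IH] k; first by rewrite GRing.subr0 -term_rev half_term.
  have Ek : (k = k - 1 + 1)%R by lia.
  apply: (@half_follow _ _ _ (erev (p (k - 1)%R))).
  - by rewrite org_rev term_rev {2}Ek p_org.
  - by rewrite erev_involutive => E; apply: (@p_red (k - 1)%R); rewrite -Ek -E.
  - by have -> : (k - Posz n.+1 = k - 1 - Posz n)%R by lia.
case ij : (i < j)%R.
  have -> : j = (i + 1 + Posz (absz (j - i - 1)%R))%R by lia.
  exact: fwd.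
have := bwd (absz (i - j)%R) i.
have -> : (i - Posz (absz (i - j)) = j)%R by lia.
by rewrite half_rev => /negbTE.
Qed.

Lemma line_dist i (n : nat) : dist treeX (org (p i)) (org (p (i + Posz n)%R)) = n.
Proof.
elim: n i => [|n IH] i; first by rewrite GRing.addr0 distxx.
rewrite (@dist_halfT _ _ (p i)); last by rewrite line_half; lia.
rewrite -p_org.
have -> : (i + Posz n.+1 = i + 1 + Posz n)%R by lia.
by rewrite IH.
Qed.

End BiInfinitePaths.

Section Axes.
Variables (G : groupType) (T : gtree G).
Implicit Types (g h t : G) (u v : vert T) (c e : edge T).

Lemma shift_power (p : int -> edge T) t (l : int) :
  (forall i, eact t (p i) = p (i + l)%R) ->
  forall j i, eact (expgz t j) (p i) = p (i + j * l)%R.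
Proof.
move=> tp; apply: int_succ_ind => [i|j].
  by rewrite eact1 GRing.mul0r GRing.addr0.
split=> H i.
  by rewrite expgz_succ eactM tp H; congr p; lia.
have -> : p i = eact t (p (i - l)%R) by rewrite tp; congr p; lia.
by rewrite -eactM -expgz_succ H; congr p; lia.
Qed.

(* Powers of [t] move a point of the axis arbitrarily far, whereas they would
   keep it at the same distance from a fixed vertex. *)
Lemma axis_no_power_fix t (p : int -> edge T) v n :
  is_axis t p -> 0 < n -> vact (t ^+ n) v = v -> False.
Proof.
move=> [po pr [l l0 tp]] n0 tv.
have tk k : vact ((t ^+ n) ^+ k) v = v.
  by elim: k => [|k IH]; rewrite ?vact1 // expgS vactM IH.
pose d := tdist v (org (p 0%R)); pose k := d.*2.+1.
have := dist_tri (gtree_tree T) v (org (p 0%R)) (vact ((t ^+ n) ^+ k) (org (p 0%R))).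
rewrite -{2}(tk k) dist_act [X in _ <= X + _]distC -/d -act_org -expgnA.
rewrite -[t ^+ (n * k)]/(expgz t (Posz (n * k))) (shift_power tp) GRing.add0r.
have -> : (Posz (n * k) * l = 0 + Posz (n * k * absz l))%R by lia.
rewrite line_dist // leqNgt => /negP; apply.
by rewrite addnn /k; nia.
Qed.

(** Concatenate the translates of a shortest path from a vertex to its image, for
    a vertex moved the least. *)
Lemma exists_axis t : (forall v, vact t v <> v) -> exists p : int -> edge T, is_axis t p.
Proof.
move=> nofix; have [[v0] _ _ _] := gtree_tree T.
have exl : exists n, `[< exists v, tdist v (vact t v) = n >].
  by exists (tdist v0 (vact t v0)); apply/asboolP; exists v0.
case: (ex_minnP exl) => l /asboolP[v vl] minl.
have {}minl u : l <= tdist u (vact t u) by apply: minl; apply/asboolP; exists u.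
have l0 : 0 < l.
  by rewrite lt0n; apply/eqP => l0; apply: (nofix v); rewrite l0 in vl; rewrite -(dist_eq0 vl).
have [s ps Es] := dist_path (gtree_tree T) v (vact t v).
have nb := shortest_reduced ps Es; rewrite vl in Es.
case: s ps Es nb => [|e0 s'] ps Es nb; first by rewrite -Es in l0.
set s := e0 :: s' in ps Es nb; pose q r := nth e0 s r.
have nthP r u w (s1 : seq (edge T)) : epath [set: edge T] u s1 w -> no_backtrack s1 ->
   r.+1 < size s1 -> org (nth e0 s1 r.+1) = term (nth e0 s1 r) /\
     nth e0 s1 r.+1 <> erev (nth e0 s1 r).
  elim: s1 r u => // b s1 IH [|r] u /= [_ _ p1]; last by case=> _; exact: (IH r _ p1).
  by case: s1 p1 {IH} => // b' s1 /= [_ ob _] [nb' _] _.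
have q0 : org (q 0%N) = v by case: ps.
have ql : term (q l.-1) = vact t v.
  have lastP (u w : vert T) (s1 : seq (edge T)) e : epath [set: edge T] u (e :: s1) w ->
      term (last e s1) = w.
    by elim: s1 u e => [|b s1 IH] u e /= [_ _ p1] //; exact: (IH _ b p1).
  by rewrite /q -Es (nth_last e0 (e0 :: s')) /=; exact: lastP ps.
(* If the path backtracked at the junction, its second vertex would be moved
   less than [v]. *)
have qred : eact t (q 0%N) <> erev (q l.-1).
  move=> E; have [l1|l1] := leqP l 1.
    have El : l.-1 = 0%N by lia.
    by rewrite El in E; exact: no_inversion E.
  have [s'' [b Es']] : exists s'' b, s' = rcons s'' b.
    have : s' <> [::] by move=> E'; rewrite /s E' /= in Es; rewrite -Es in l1.
    by case/lastP: (s') => [//|s'' b] _; exists s'', b.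
  have qlb : q l.-1 = b.
    by rewrite /q -Es /s Es' /= size_rcons /= nth_rcons ltnn eqxx.
  have := minl (term (q 0%N)); rewrite -act_term E term_rev qlb leqNgt => /negP; apply.
  have [_ _] := ps; rewrite Es' -cats1 => /epath_catE[w p1 [_ ow _]].
  rewrite -ow in p1; have := dist_le (gtree_tree T) p1.
  by rewrite -Es /s Es' /= size_rcons !ltnS => /leq_trans -> //.
pose p (i : int) := eact (expgz t (i %/ l)%Z) (q (absz (i %% l)%Z)).
have pE (m : int) r : r < l -> p (m * Posz l + Posz r)%R = eact (expgz t m) (q r).
  move=> rl; have lz : (Posz l != 0)%R by lia.
  rewrite /p divzMDl // modzMDl divz_small ?modz_small; [|lia..].
  by rewrite GRing.addr0.
have rep (i : int) : exists (m : int) r, r < l /\ i = (m * Posz l + Posz r)%R.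
  have l0' : (0 < Posz l)%R by lia.
  have lz : (Posz l != 0)%R by lia.
  have := modz_ge0 i lz; have := ltz_pmod i l0'.
  exists (i %/ l)%Z, (absz (i %% l)%Z); split; first lia.
  by rewrite {1}(divz_eq i l); congr (_ + _)%R; lia.
have qs r : r.+1 < l -> org (q r.+1) = term (q r) /\ q r.+1 <> erev (q r).
  by rewrite -Es; exact: nthP ps nb.
exists p; split.
- move=> i; have [m [r [rl ->]]] := rep i.
  have [r1|r1] := ltnP r.+1 l.
    have -> : (m * Posz l + Posz r + 1 = m * Posz l + Posz r.+1)%R by lia.
    by rewrite !pE // act_org act_term (qs r r1).1.
  have Er : r = l.-1 by lia.
  have -> : (m * Posz l + Posz r + 1 = (m + 1) * Posz l + Posz 0)%R by lia.
  by rewrite !pE // act_org act_term q0 Er ql expgz_succ vactM.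
- move=> i; have [m [r [rl ->]]] := rep i; rewrite pE // act_rev.
  have [r1|r1] := ltnP r.+1 l.
    have -> : (m * Posz l + Posz r + 1 = m * Posz l + Posz r.+1)%R by lia.
    by rewrite pE // => /eact_inj; exact: (qs r r1).2.
  have Er : r = l.-1 by lia.
  have -> : (m * Posz l + Posz r + 1 = (m + 1) * Posz l + Posz 0)%R by lia.
  by rewrite pE // expgz_succ eactM => /eact_inj; rewrite Er.
- exists (Posz l); first by lia.
  move=> i; have [m [r [rl ->]]] := rep i.
  have -> : (m * Posz l + Posz r + Posz l = (1 + m) * Posz l + Posz r)%R by lia.
  by rewrite !pE // expgzD eactM /= expg1.
Qed.

End Axes.

(** * Vertex groups are elliptic in the other tree *)

Section Lines.
Variables (G : groupType) (S : gtree G) (t : G) (p : int -> edge S).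
Hypothesis tp : is_axis t p.
Implicit Types (g h : G) (u v : vert S) (c e : edge S) (i j k : int).

Lemma on_axis_rev c : on_axis p c -> on_axis p (erev c).
Proof. by move=> [i [E|E]]; exists i; [right; rewrite erev_involutive|left]. Qed.

Lemma on_axis_org c : on_axis p c -> exists i, org c = org (p i).
Proof.
move=> [i [<-|E]]; first by exists i.
by exists (i + 1)%R; case: tp => -> _ _; rewrite E term_rev.
Qed.

(* The axis is connected, so it stays on one side of an edge not on it. *)
Lemma axis_side c : ~ on_axis p c ->
  forall i, halftree (gtree_tree S) c (org (p i)) = halftree (gtree_tree S) c (org (p 0%R)).
Proof.
move=> nc; have [po _ _] := tp; apply: int_succ_ind => // i; rewrite po.
rewrite (@half_step _ (gtree_tree S) c (p i)) //.
  by move=> E; apply: nc; exists i; left.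
by move=> E; apply: nc; exists i; right.
Qed.

Hypothesis t_comm : forall h, exists n (m : int),
  [/\ 0 < n, m <> 0%R & (h * t * h^-1) ^+ n = expgz t m].

(** The translate by [h] of the axis of [t] is an axis of [h * t * h^-1]. A
    common power of this element and of [t] moves the two axes along while
    keeping their distance, so neither can leave the other. *)
Lemma commensurated_axis_invariant h k : on_axis p (eact h (p k)).
Proof.
have [po pr [l l0 pl]] := tp; have [n [m [n0 m0 Ex]]] := t_comm h.
pose p' i := eact h (p i).
have po' i : org (p' (i + 1)%R) = term (p' i) by rewrite act_org act_term po.
have pr' i : p' (i + 1)%R <> erev (p' i) by rewrite act_rev => /eact_inj; exact: pr.
have tau i : eact (expgz t m) (p' i) = p' (i + Posz n * l)%R.
  rewrite -Ex -[_ ^+ n]/(expgz _ (Posz n)); apply: shift_power => {}i.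
  by rewrite /p' -eactM mulgVK eactM pl.
have distp j : tdist (org (p (j * (m * l))%R)) (org (p' (j * (Posz n * l))%R)) =
    tdist (org (p 0%R)) (org (p' 0%R)).
  have := shift_power (shift_power pl m) j 0%R; have := shift_power tau j 0%R.
  by rewrite !GRing.add0r => <- <-; rewrite !act_org dist_act.
set D := tdist _ _ in distp.
apply: contrapT => /axis_side side; set c := eact h (p k) in side.
(* [J] steps along the translated axis lead deeper than [D] beyond [c]. *)
pose J : int := (Posz (absz k) + Posz D + 1)%R.
case s0 : (halftree (gtree_tree S) c (org (p 0%R))) side => side.
  have Ei : ((- J) * (Posz n * l) = k - Posz (absz (k - (- J) * (Posz n * l))%R))%R by rewrite /J; nia.
  set r := absz _ in Ei.
  have rD : D <= r by rewrite /r /J; nia.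
  have hf : halftree (gtree_tree S) c (org (p' ((- J) * (Posz n * l))%R)) = false.
    by rewrite (line_half (gtree_tree S) po' pr') Ei; lia.
  have dE : tdist (org (p' (k - Posz r)%R)) (org c) = r.
    have Ek : (k = k - Posz r + Posz r)%R by lia.
    by rewrite [org c]/(org (p' k)) {2}Ek line_dist.
  by have := cross (side ((- J) * (m * l))%R) hf; rewrite distp Ei (distC _ (org c)) dE; lia.
have Ei : (J * (Posz n * l) = k + 1 + Posz (absz (J * (Posz n * l) - k - 1)%R))%R by rewrite /J; nia.
set r := absz _ in Ei.
have rD : D <= r by rewrite /r /J; nia.
have hf : halftree (gtree_tree S) c (org (p' (J * (Posz n * l))%R)).
  by rewrite (line_half (gtree_tree S) po' pr') Ei; lia.
have dE : tdist (term c) (org (p' (k + 1 + Posz r)%R)) = r.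
  have -> : term c = org (p' (k + 1)%R) by rewrite po'.
  by rewrite line_dist.
by have := cross hf (side (J * (m * l))%R); rewrite distC distp Ei distC dE; lia.
Qed.

(** Since all conjugates of [t] are commensurable to [t], its axis is invariant,
    hence is the whole tree. *)
Lemma commensurated_axis_full c : on_axis p c.
Proof.
have [po _ _] := tp.
have gF g e : on_axis p e -> on_axis p (eact g e).
  move=> [i [<-|E]]; first exact: commensurated_axis_invariant.
  rewrite -(erev_involutive (eact g e)) act_rev -E; apply: on_axis_rev.
  exact: commensurated_axis_invariant.
have con i : connected_in (on_axis p) (org (p 0%R)) (org (p i)).
  move: i; apply: int_succ_ind => [|i]; first by exists [::].
  have h : connected_in (on_axis p) (org (p i)) (org (p (i + 1)%R)).
    by rewrite po; apply: connected_in_edge; exists i; left.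
  split=> h'; first exact: connected_in_trans h' h.
  by apply: connected_in_trans h' (connected_in_sym _ h); exact: on_axis_rev.
have [|||||_ FT] := @gtree_minimal G S [set v | exists i, v = org (p i)] (on_axis p).
- by exists (org (p 0%R)); exists 0%R.
- by move=> e pe; split; [exact: on_axis_org|exact: on_axis_rev].
- move=> u v [i ->] [j ->]; apply: connected_in_trans (con j).
  by apply: connected_in_sym (con i); exact: on_axis_rev.
- move=> g v [i ->]; rewrite -act_org; apply: on_axis_org; apply: gF.
  by exists i; left.
- exact: gF.
by have : on_axis p c by rewrite FT.
Qed.

(** In a line, a component of a proper invariant subforest is a segment, so its
    stabilizer fixes a vertex. *)
Lemma line_component_fixed_vertex (F : set (edge S)) e (K : set G)
    (Y : set (vert S)) (y0 : vert S) :
  (forall c, F c -> F (erev c)) -> (forall g c, F c -> F (eact g c)) -> ~ F e ->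
  (forall x, K x -> K x^-1) -> Y y0 -> (forall x y, K x -> Y y -> Y (vact x y)) ->
  (forall u v, Y u -> Y v -> connected_in F u v) ->
  exists v, forall x, K x -> vact x v = v.
Proof.
move=> symF gF nFe KV Yy0 KY conY; have [po pr [l l0 pl]] := tp.
have vertE u : exists i, u = org (p i).
  have [c <-] : exists c : edge S, org c = u.
    have [->|ne] := pselect (u = org e); first by exists e.
    by have [a oa _] := edge_toward (gtree_tree S) ne; exists a.
  exact/on_axis_org/commensurated_axis_full.
have [k nFk] : exists k, ~ F (p k).
  have [k [E|E]] := commensurated_axis_full e; exists k; rewrite E // => /symF.
  by rewrite erev_involutive.
have nFj j : ~ F (p (k + j * l)%R).
  rewrite -(shift_power pl j) => /(gF (expgz t j)^-1); rewrite eactK; exact: nFk.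
have [i Ei] := vertE y0.
have [a [b [nFa nFb ai ib bl]]] : exists a b,
    [/\ ~ F (p a), ~ F (p b), (a < i)%R, (i <= b)%R & (b = a + l)%R].
  pose j := ((i - 1 - k) %/ l)%Z.
  have lz : (l != 0)%R by lia.
  exists (k + j * l)%R, (k + (j + 1) * l)%R; split=> //.
  - have := modz_ge0 (i - 1 - k)%R lz; have := divz_eq (i - 1 - k)%R l; rewrite -/j; lia.
  - have := ltz_pmod (i - 1 - k)%R l0; have := divz_eq (i - 1 - k)%R l; rewrite -/j; lia.
  - lia.
have nFr c : ~ F c -> ~ F (erev c) by move=> nF /symF; rewrite erev_involutive.
apply: (@bounded_fixed_vertex _ _ K Y y0 (absz l)) => // y Yy.
have [s ps] := conY y0 y Yy0 Yy; have [r Er] := vertE y.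
have := half_path (gtree_tree S) nFa (nFr _ nFa) ps.
have := half_path (gtree_tree S) nFb (nFr _ nFb) ps.
rewrite Ei Er !(line_half (gtree_tree S) po pr) => h1 h2.
case ir : (i <= r)%R.
  have -> : r = (i + Posz (absz (r - i)%R))%R by lia.
  by rewrite line_dist //; lia.
have -> : i = (r + Posz (absz (i - r)%R))%R by lia.
by rewrite distC line_dist //; lia.
Qed.

End Lines.

Section Elliptic.
Variables (G : groupType) (S T : gtree G).
Hypotheses (SD : in_D S) (TD : in_D T).

(** If a vertex stabilizer of [T] were not elliptic in [S], a generator would
    have an axis in [S], and this axis would be all of [S], so that the vertex
    stabilizers of a collapse of a proper subforest would all be elliptic. *)
Lemma vertex_groups_elliptic (F : set (edge S)) (TH : gtree G) (w : vert TH) e :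
  is_collapse F TH -> ~ elliptic_in_D (vstab w) -> ~ F e ->
  forall v : vert T, exists y : vert S, forall g, vact g v = v -> vact g y = y.
Proof.
move=> [symF gF [q [j [qsurj qE _ _ [qact _]]]]] nell nFe v.
have [t injt Et] := TD.1 v; apply: contrapT => nofix.
have tnofix (y : vert S) : vact t y <> y.
  move=> ty; apply: nofix; exists y => g gv.
  have : vstab v g by []; rewrite Et => -[i _ <-].
  exact: (subgroup_expgz i (vstab_subgroup y)).
have [p tp] := exists_axis tnofix.
have tc := fun h => conj_generator_power TD h injt Et.
have [y0 qy0] := qsurj w.
have [|||y yfix] := @line_component_fixed_vertex _ _ _ _ tp tc F e (vstab w)
    [set u | q u = w] y0 symF gF nFe _ qy0.
- by move=> k kw; have [_ _ HV] := vstab_subgroup w; exact: HV.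
- by move=> k y kw yw; rewrite /= qact yw.
- by move=> u u' uw u'w; apply/qE; rewrite uw u'w.
by apply: nell; exists S => //; exists y => k; exact: yfix.
Qed.

End Elliptic.

(** * Colouring a tree by the two sides of an edge of another tree *)

(** Choose the image of one vertex in each orbit. *)
Lemma equivariant_map (G : groupType) (T S : gtree G) :
  (forall v : vert T, exists y : vert S, forall g, vact g v = v -> vact g y = y) ->
  exists f : vert T -> vert S, forall g v, f (vact g v) = vact g (f v).
Proof.
move=> ell; pose orb (v : vert T) : set (vert T) := [set u | exists g, u = vact g v].
have orbP v : exists u, orb v u by exists v, 1; rewrite vact1.
have orb_act g v : orb (vact g v) = orb v.
  apply/seteqP; split=> [_ [h ->]|_ [h ->]].
    by exists (h * g); rewrite vactM.
  by exists (h * g^-1); rewrite vactM vactK.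
have [r rP] : exists r : vert T -> vert T,
    (forall v, orb v (r v)) /\ forall g v, r (vact g v) = r v.
  have [[o] _ _ _] := gtree_tree T.
  pose rep (O : set (vert T)) := if pselect (exists u, O u) is left h then sval (cid h) else o.
  exists (fun v => rep (orb v)); split=> [v|g v]; last by rewrite orb_act.
  by rewrite /rep; case: pselect => // h; case: cid.
have [rorb ract] := rP.
have rep v : exists g, v = vact g (r v).
  by have [h ->] := rorb v; exists h^-1; rewrite vactK.
have [k kP] := choice rep; have [y yP] := choice ell.
exists (fun v => vact (k v) (y (r v))) => g v; rewrite ract.
have fixr : vact ((k (vact g v))^-1 * (g * k v)) (r v) = r v.
  by rewrite !vactM -kP {2}(kP (vact g v)) ract vactK.
by rewrite -vactM -{1}(yP _ _ fixr) -vactM mulVKg.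
Qed.

Lemma list_bound (X : Type) (L : seq X) (P : X -> nat -> Prop) :
  (forall x m n, m <= n -> P x m -> P x n) ->
  (forall x, List.In x L -> exists n, P x n) ->
  exists n, forall x, List.In x L -> P x n.
Proof.
move=> mono; elim: L => [|a L IH] ex; first by exists 0.
have [x xL|n nP] := IH; first by apply: ex; right.
have [|m mP] := ex a; first by left.
exists (maxn m n) => x [<-|/nP]; first exact: mono (leq_maxl _ _) mP.
exact: mono (leq_maxr _ _).
Qed.

Lemma repeated_value (X : Type) (L : seq X) (F : nat -> X) :
  (forall n, List.In (F n) L) -> exists m n, m < n /\ F m = F n.
Proof.
move=> FL; have idx n : exists i : 'I_(size L), nth (F 0) L i = F n.
  have := FL n; elim: L {FL} => //= a L IH [->|/IH[i iP]]; first by exists ord0.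
  by exists (lift ord0 i).
have [j jP] := choice idx.
have [inj|ninj] := pselect (injective (fun n : 'I_(size L).+1 => j n)).
  by have := leq_card _ inj; rewrite !card_ord ltnn.
apply: contrapT => nF; apply: ninj => m n E.
have {}E : F m = F n by rewrite -(jP n) -[j n]E jP.
apply: val_inj; case: (ltngtP m n) => //= mn; exfalso; apply: nF.
  by exists m, n.
by exists n, m.
Qed.

Section EndColours.
Variables (G : groupType) (T : gtree G) (chi : vert T -> bool).
Implicit Types (s : bool) (u v o : vert T) (a b c : edge T).

(** All ends of [T] beyond [b] have the colour [s]: vertices close to [b] are
    disregarded, as a pulled back half-tree is only known up to a bounded set. *)
Definition end_colour b s := exists M, forall u, thalf b u -> M <= tdist (org b) u -> chi u = s.

Lemma far_point b M : exists2 u, thalf b u & M <= tdist (org b) u.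
Proof.
have [c [c1 c2]] := half_deep b M; exists (term c); first exact/c1/half_term.
exact/ltnW/c2/half_term.
Qed.

Lemma end_colour_unique b s s' : end_colour b s -> end_colour b s' -> s = s'.
Proof.
move=> [M HM] [M' HM']; have [u hu du] := far_point b (maxn M M').
by rewrite -(HM u hu) -?(HM' u hu) //; apply: leq_trans du; rewrite ?leq_maxl ?leq_maxr.
Qed.

Lemma not_end_colour b s : ~ end_colour b s -> forall M, exists u,
  [/\ thalf b u, M <= tdist (org b) u & chi u = ~~ s].
Proof.
move=> ne M; apply: contrapT => nu; apply: ne; exists M => u hu du.
apply: contrapT => /eqP ns; apply: nu; exists u; split=> //.
by case: (chi u) s ns => -[].
Qed.

Hypothesis cobound : forall o, exists N, forall c,
  chi (org c) <> chi (term c) -> tdist o (org c) <= N.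
Hypothesis unbounded : forall s o n, exists2 u, n <= tdist o u & chi u = s.

(** Take the vertex at the end of a deepest edge beyond which both colours
    occur far away. *)
Lemma bicoloured_vertex : exists v,
  (forall s, exists2 b, org b = v & end_colour b s) /\
  (forall b b', org b = v -> org b' = v ->
     (forall s, ~ end_colour b s) -> (forall s, ~ end_colour b' s) -> b = b').
Proof.
have [[o] _ _ _] := gtree_tree T; have [N NP] := cobound o.
(* An edge pointing away from [o] is thick when both colours occur far beyond
   it; [N.+1] makes the end of a thick edge close to [o]. *)
pose thick a := thalf a o = false /\
  forall s, exists u, [/\ thalf a u, N.+1 < tdist o u & chi u = s].
have thin b : thalf b o = false -> ~ thick b ->
    exists s, forall u, thalf b u -> N.+1 < tdist o u -> chi u = s.
  move=> bo nthick; apply: contrapT => ns; apply: nthick; split=> // s.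
  apply: contrapT => nu; apply: ns; exists (~~ s) => u hu du.
  case: (boolP (chi u == s)) => [/eqP E|]; last by case: (chi u) s {nu} => -[].
  by exfalso; apply: nu; exists u.
have thin_end_colour b s : (forall u, thalf b u -> N.+1 < tdist o u -> chi u = s) -> end_colour b s.
  move=> bs; exists (N.+2 + tdist o (org b)) => u hu du; apply: bs => //.
  by have := dist_tri (gtree_tree T) o (org b) u; rewrite (distC _ (org b) o); lia.
have thin_toward v s u b : org b = v -> thalf b o = false -> ~ thick b ->
    thalf b u -> N.+1 < tdist o u -> chi u = s -> end_colour b s.
  move=> ob bo nb hu du cu; have [s' s'P] := thin b bo nb.
  by apply: thin_end_colour => u' hu' du'; rewrite (s'P u') // -cu -(s'P u).
have thick_near a : thick a -> tdist o (org a) <= N.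
  move=> [ao at_]; rewrite leqNgt; apply/negP => far.
  have cst u : thalf a u -> chi u = chi (term a).
    move: u; apply: half_ind => // b hb1 hb2 _ <-; apply: contrapT => /NP.
    by rewrite distC (cross hb1 ao) (distC _ (org a)); lia.
  have [u [hu _ cu]] := at_ (~~ chi (term a)).
  by move: cu; rewrite cst //; case: chi.
have [[a0 tha0]|nothick] := pselect (exists a, thick a); last first.
  exists o; have bo b : org b = o -> thalf b o = false by move=> <-; exact: half_org.
  have nt b : ~ thick b by move=> h; apply: nothick; exists b.
  split=> [s|b b' ob _ /(_ _) nb _].
    have [u du cu] := unbounded s o N.+2.
    have ne : o <> u by move=> E; rewrite E distxx in du.
    have [b ob hb] := edge_toward_half (gtree_tree T) ne; exists b => //.
    by apply: (thin_toward o s u) => //; exact: bo.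
  have [s sP] := thin b (bo b ob) (nt b).
  by case: (nb s); exact: thin_end_colour.
have exD : exists n, `[< exists2 a, thick a & tdist o (org a) = n >].
  by exists (tdist o (org a0)); apply/asboolP; exists a0.
have ubD n : `[< exists2 a, thick a & tdist o (org a) = n >] -> n <= N.
  by move=> /asboolP[a /thick_near + <-].
case: (ex_maxnP exD ubD) => D /asboolP[a tha aD] maxD {a0 tha0}.
exists (term a); have [ao at_] := tha.
have next b : org b = term a -> b <> erev a -> thalf b o = false /\ ~ thick b.
  move=> ob nb; split; first by apply/negP => /(half_follow ob nb); rewrite ao.
  move=> thb; have : tdist o (org b) <= D by apply: maxD; apply/asboolP; exists b.
  by rewrite ob distC (dist_halfF ao) distC aD ltnn.
split=> [s|b b' ob ob' nb nb'].
  have [u [hu du cu]] := at_ s.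
  have ne : term a <> u.
    move=> E; move: du; rewrite -E distC (dist_halfF ao) distC ltnS ltnNge.
    by rewrite thick_near.
  have [b ob hb] := edge_toward_half (gtree_tree T) ne; exists b => //.
  have nb : b <> erev a by move=> E; rewrite E half_rev hu in hb.
  by have [bo thb] := next b ob nb; apply: (thin_toward _ s u).
have only c : org c = term a -> (forall s, ~ end_colour c s) -> c = erev a.
  move=> oc nc; apply: contrapT => ne; have [co thc] := next c oc ne.
  by have [s sP] := thin c co thc; apply: (nc s); exact: thin_end_colour.
by rewrite (only b) // (only b').
Qed.

End EndColours.

Section PulledBackColouring.
Variables (G : groupType) (S T : gtree G) (f : vert T -> vert S) (e : edge S).
Implicit Types (o u v : vert T) (c : edge T).
Hypothesis f_act : forall g v, f (vact g v) = vact g (f v).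
Hypotheses (SD : in_D S) (TD : in_D T).

Let chi (u : vert T) : bool := thalf e (f u).

(** The stabilizer of [e] is commensurable to the vertex groups of [T], because
    these fix vertices of [S]. *)
Lemma estab_generator_power o : exists a m,
  [/\ estab e = range (expgz a), 0 < m & vact (a ^+ m) o = o].
Proof.
have [a inja Ea] := SD.2 e; have [t injt Et] := TD.1 o.
have tv : vact t o = o by have : vstab o t by rewrite Et; exists 1%R; rewrite //= expg1.
have [n n0 te] : exists2 n, 0 < n & eact (t ^+ n) e = e.
  by apply: (@vstab_power_edge _ _ SD (f o)); rewrite -f_act tv.
have : estab e (t ^+ n) by []; rewrite Ea => -[i _ Ei].
exists a, (absz i); split=> //.
  rewrite absz_gt0; apply/eqP => i0; move: Ei; rewrite i0 -[t ^+ n]/(expgz t (Posz n)).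
  by rewrite -[expgz a _]/(expgz t 0%R) => /injt; lia.
have tn : vstab o (expgz a i).
  by rewrite Ei -[t ^+ n]/(expgz t (Posz n)); exact: (subgroup_expgz _ (vstab_subgroup o)).
suff : vstab o (expgz a (Posz (absz i))) by [].
have [->//|->] : Posz (absz i) = i \/ Posz (absz i) = (- i)%R by lia.
by rewrite expgzN; have [_ _ HV] := vstab_subgroup o; exact: HV.
Qed.

Lemma estab_power_vstab o k : eact k e = e -> exists2 n, 0 < n & vact (k ^+ n) o = o.
Proof.
move=> ke; have [a [m [Ea m0 am]]] := estab_generator_power o.
have : estab e k by []; rewrite Ea => -[j _ <-]; exists m => //.
rewrite -[_ ^+ m]/(expgz _ (Posz m)) expgzM GRing.mulrC -expgzM.
exact: (subgroup_expgz _ (vstab_subgroup o)).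
Qed.

Lemma estab_orbit_bounded o : exists M, forall k, eact k e = e -> tdist o (vact k o) <= M.
Proof.
have [a [m [Ea m0 am]]] := estab_generator_power o.
exists (\max_(r < m) tdist o (vact (a ^+ r) o)) => k ke.
have : estab e k by []; rewrite Ea => -[j _ <-].
have mz : (Posz m != 0)%R by lia.
have r0 := modz_ge0 j mz; have rm : ((j %% m)%Z < Posz m)%R by apply: ltz_pmod; lia.
have rm' : absz (j %% m)%Z < m by lia.
have -> : j = (Posz (absz (j %% m)%Z) + Posz m * (j %/ m)%Z)%R.
  by rewrite {1}(divz_eq j m); lia.
rewrite expgzD -expgzM vactM.
have -> : vact (expgz (expgz a m) (j %/ m)%Z) o = o.
  exact: (subgroup_expgz _ (vstab_subgroup o)).
exact: (leq_bigmax (Ordinal rm')).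
Qed.

Variable cs : seq (edge T).
Hypothesis cs_all : forall c, exists g, exists2 c0, List.In c0 cs & c = eact g c0.

(** Up to the stabilizer of [e], which has bounded orbits in [T], only finitely
    many edges of [T] have their ends mapped to different sides of [e]. *)
Lemma coboundary_bounded o : exists N, forall c,
  chi (org c) <> chi (term c) -> tdist o (org c) <= N.
Proof.
have [M MP] := estab_orbit_bounded o.
have [N NP] : exists N, forall c0, List.In c0 cs -> forall g,
    chi (org (eact g c0)) <> chi (term (eact g c0)) -> tdist o (org (eact g c0)) <= N.
  apply: list_bound => [c0 m n mn H g /H|c0 _]; first by move/leq_trans; apply.
  have [L LP] := separating_finite (gtree_tree S) (f (org c0)) (f (term c0)).
  have [N NP] : exists N, forall b, List.In b L -> forall g, eact g^-1 e = b ->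
      tdist o (org (eact g c0)) <= N.
    apply: list_bound => [b m n mn H g /H|b _]; first by move/leq_trans; apply.
    have [[h hb]|nh] := pselect (exists h, eact h^-1 e = b); last first.
      by exists 0 => g gb; case: nh; exists g.
    exists (M + tdist o (org (eact h c0))) => g gb.
    have ke : eact (g * h^-1) e = e by rewrite eactM hb -gb eactVK.
    have := dist_tri (gtree_tree T) (vact (g * h^-1) o) o (org (eact g c0)).
    have -> : org (eact g c0) = vact (g * h^-1) (org (eact h c0)).
      by rewrite !act_org -vactM mulgVK.
    by rewrite dist_act; have := MP _ ke; lia.
  exists N => g ne; apply: (NP (eact g^-1 e)) => //; apply: LP; move: ne.
  by rewrite !act_org act_term /chi !f_act !half_actV invgK.
by exists N => c; have [g [c0 c0s ->]] := cs_all c; exact: NP.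
Qed.

Lemma lipschitz : exists L, forall u v, tdist (f u) (f v) <= L * tdist u v.
Proof.
have [L LP] : exists L, forall c0, List.In c0 cs -> tdist (f (org c0)) (f (term c0)) <= L.
  apply: list_bound => [c0 m n mn /leq_trans|c0 _]; first by apply.
  by eexists; exact: leqnn.
have {}LP c : tdist (f (org c)) (f (term c)) <= L.
  have [g [c0 c0s ->]] := cs_all c.
  by rewrite act_org act_term !f_act dist_act; exact: LP.
exists L => u v; have [s p <-] := dist_path (gtree_tree T) u v.
elim: s u p => [|c s IH] u /= p; first by rewrite p distxx.
case: p => _ <- /IH; have := LP c.
have := dist_tri (gtree_tree S) (f (term c)) (f (org c)) (f v).
by rewrite mulnS; lia.
Qed.

(** Each side of [e] contains translates of [f o] arbitrarily far away, and [f]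
    is Lipschitz. *)
Lemma colours_unbounded s o n : exists2 u, n <= tdist o u & chi u = s.
Proof.
have [L LP] := lipschitz; pose e' := if s then e else erev e.
have e's u : thalf e' (f u) -> chi u = s.
  by rewrite /e' /chi; case: (s) => //; rewrite half_rev => /negbTE.
have [c [c1 c2]] := half_deep e' (L * n + tdist (org e') (f o)).
have [g hg] := orbit_meets_half (f o) c; rewrite -f_act in hg.
exists (vact g o); last exact/e's/c1.
rewrite leqNgt; apply/negP => lt; have := c2 _ hg.
have := dist_tri (gtree_tree S) (f o) (org e') (f (vact g o)).
have := LP o (vact g o); have : L * tdist o (vact g o) <= L * n by rewrite leq_mul2l ltnW ?orbT.
lia.
Qed.

End PulledBackColouring.

(** * Admissible cuts in the Whitehead graph *)

Lemma eq_or_neg (s s' : bool) : s' = s \/ s' = ~~ s.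
Proof. by case: s s' => -[]; auto. Qed.

Section EllipticTranslates.
Variables (G : groupType) (S : gtree G) (e : edge S) (y : vert S).
Implicit Types (g k : G) (u : vert S) (s : bool).

(** Otherwise [org e] and its image would not be equidistant from [y]. *)
Lemma elliptic_half_sub k : vact k y = y ->
  (forall u, thalf (eact k e) u -> thalf e u) -> eact k e = e.
Proof.
move=> ky sub; apply: contrapT => ne.
have nr : eact k e <> erev e by exact: no_inversion.
have ht : thalf e (term (eact k e)) by apply/sub/half_term.
have ho : thalf e (org (eact k e)) by rewrite (half_step _ ne nr).
have hyk : thalf (eact k e) y = thalf e y by rewrite -{1}ky half_act.
have dy : tdist y (org (eact k e)) = tdist y (org e) by rewrite act_org -{1}ky dist_act.
case hy : (thalf e y); last first.
  by have := cross ho hy; rewrite distC dy (distC _ _ y); lia.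
have hoe : thalf (eact k e) (org e) = false by apply/negP => /sub; rewrite half_org.
rewrite hy in hyk; have := cross hyk hoe; have := dist_halfT hyk.
rewrite !(distC _ _ y) dy => -> [/esym/eqP]; rewrite -[X in _ == X]addn0 eqn_add2l.
by move=> /eqP/dist_eq0 E; rewrite E half_org in ho.
Qed.

Definition disjoint_sides s k :=
  forall u, thalf (eact k e) u = s -> thalf e u = s -> False.

(** The two nested positions of [e] and its translate are excluded by
    [elliptic_half_sub]. *)
Lemma elliptic_trichotomy k : vact k y = y ->
  [\/ eact k e = e, disjoint_sides true k | disjoint_sides false k].
Proof.
move=> ky; have [E|ne] := pselect (eact k e = e); first by constructor 1.
have [d|d|sub|sub] := half_nested (gtree_tree S) ne (@no_inversion _ _ k e).
- by constructor 2.
- by constructor 3.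
- by constructor 1; exact: elliptic_half_sub.
- constructor 1; rewrite -[in RHS](eactVK k e); congr eact; apply/esym.
  apply: elliptic_half_sub; first by rewrite -{1}ky vactK.
  by move=> u; rewrite half_actV invgK -(half_act k e u) => /sub.
Qed.

(** Two elements of a vertex group of the two kinds would have a product that
    maps a half-tree into itself, and one of them would invert [e]. *)
Lemma disjoint_sides_exclusive k k' : vact k y = y -> vact k' y = y ->
  disjoint_sides true k -> disjoint_sides false k' -> False.
Proof.
move=> ky k'y dk dk'.
have h1 u : thalf (eact (k' * k) e) u -> thalf (eact k' e) u = false.
  rewrite eactM !half_actV => h; apply/negP => h'; apply: (dk (vact k'^-1 u)) => //.
  by rewrite half_actV.
have h2 u : thalf (eact k' e) u = false -> thalf e u.
  by move=> h; apply: contrapT => /negP/negbTE; exact: dk'.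
have kk : eact (k' * k) e = e.
  by apply: elliptic_half_sub => [|u /h1/h2//]; rewrite vactM ky.
apply: (@no_inversion _ _ k' e); apply: (@half_inj _ (gtree_tree S)) => u.
rewrite half_rev; case hu : (thalf e u).
  by apply: h1; rewrite kk.
by apply: contrapT => /negP/negbTE/h2; rewrite hu.
Qed.

End EllipticTranslates.

Lemma wh_adj_sym (G : groupType) (T : gtree G) (GG : set G) (v : vert T) b b' :
  wh_adj GG v b b' -> wh_adj GG v b' b.
Proof.
move=> [vb vb' ne [g [x [p [gg ax h h']]]]]; split=> //; first exact: nesym.
by exists g, x, p.
Qed.

Lemma joined_sym (X : Type) (R : X -> X -> Prop) (P : set X) x y :
  (forall x y, R x y -> R y x) -> joined R P x y -> joined R P y x.
Proof.
move=> symR; elim=> [u w [pu pw ruw]|u|u w z _ h1 _ h2].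
- by apply: rt_step; split=> //; exact: symR.
- exact: rt_refl.
- exact: rt_trans h2 h1.
Qed.

Lemma joined_ind (X : Type) (R : X -> X -> Prop) (S : set X) (x : X) (P : X -> Prop) :
  P x -> (forall u w, S u -> S w -> joined R S x u -> R u w -> P u -> P w) ->
  forall z, joined R S x z -> P z.
Proof.
move=> Px PS z xz; suff: joined R S x z /\ P z by case.
have H : forall a b, joined R S a b -> joined R S x a /\ P a -> joined R S x b /\ P b.
  move=> a b; elim=> [u w [Su Sw Ruw] [xu Pu]|//|u w t _ h1 _ h2 /h1/h2//].
  by split; [apply: rt_trans xu _; apply: rt_step|exact: (PS u)].
by apply: (H x z) => //; split=> //; exact: rt_refl.
Qed.

Section Whitehead.
Variables (G : groupType) (S T : gtree G) (A : set (set G)) (GG : set G).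
Variables (f : vert T -> vert S) (e : edge S).
Hypothesis f_act : forall g v, f (vact g v) = vact g (f v).
Hypotheses (SD : in_D S) (TD : in_D T).
Implicit Types (g h k : G) (u v : vert T) (b c : edge T) (s : bool).

Let chi (u : vert T) : bool := thalf e (f u).

(* An element fixing [e] has a power that fixes a vertex of [T]. *)
Lemma axis_not_estab h (p : int -> edge T) n :
  is_axis h p -> 0 < n -> eact (h ^+ n) e = e -> False.
Proof.
move=> ax n0 /(estab_power_vstab f_act SD TD (org (p 0%R)))[m m0].
by rewrite -expgnA; apply: axis_no_power_fix ax _; rewrite muln_gt0 n0.
Qed.

(* If the orbit of [y] eventually lies on the other side of [e] than that of
   [y'], the translates of [e] separate [y] and [y'], so repeat. *)
Lemma eventually_separated x (y y' : vert S) s M :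
  (forall n, thalf e (vact (x ^+ n) y') = s) ->
  (forall n, M <= n -> thalf e (vact (x ^+ n) y) = ~~ s) ->
  exists2 d, 0 < d & eact (x ^+ d) e = e.
Proof.
move=> hy' hy; have [L LP] := separating_finite (gtree_tree S) y y'.
have [n|m [n [mn E]]] := @repeated_value _ L (fun n => eact (x ^+ (M + n))^-1 e).
  apply: LP; rewrite !half_actV invgK hy ?leq_addr // hy'.
  by case: (s).
exists (n - m)%N; first by rewrite subn_gt0.
have En : (M + n = (n - m) + (M + m))%N by lia.
move: E; rewrite En (expgnDr x (n - m)) invgM eactM => /eact_inj {1}->.
by rewrite eactVK.
Qed.

(** Some orbit of [h] in [S] stays on one side of [e]; this holds when [h]
    preserves a subtree that avoids [e]. *)
Definition one_sided h := exists (y' : vert S) s,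
  forall n : int, thalf e (vact (expgz h n) y') = s.

(** The two half-trees contain the two ends of the axis of [h]. If their colours
    differ, then in one of the two directions the translates of [f (org (p i))]
    are finally on the other side of [e] than an orbit that never crosses [e],
    and [eventually_separated] applies. *)
Lemma axis_colours h (p : int -> edge T) i s : is_axis h p -> one_sided h ->
  end_colour chi (p i) s -> end_colour chi (erev (p (i - 1)%R)) (~~ s) -> False.
Proof.
move=> ax [y' [s0 hy']] [M HM] [M' HM']; have [po pr [l l0 hp]] := ax.
have pow j : vact (expgz h j) (org (p i)) = org (p (i + j * l)%R).
  by rewrite -act_org (shift_power hp).
have oi : org (erev (p (i - 1)%R)) = org (p i).
  by rewrite org_rev -po; congr (org (p _)); lia.
have c1 n : maxn M 1 <= n -> thalf e (vact (h ^+ n) (f (org (p i)))) = s.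
  move=> nM; rewrite -f_act; apply: HM; rewrite -[h ^+ n]/(expgz h (Posz n)) pow.
    by rewrite line_half //; nia.
  have -> : (i + Posz n * l = i + Posz (n * absz l))%R by lia.
  by rewrite line_dist //; nia.
have c2 n : maxn M' 1 <= n -> thalf e (vact (h^-1 ^+ n) (f (org (p i)))) = ~~ s.
  move=> nM; have En : h^-1 ^+ n = expgz h (- Posz n)%R by rewrite expgzN expVgn.
  rewrite -f_act; apply: HM'; rewrite En pow ?oi.
    by rewrite half_rev line_half //; nia.
  have Ei : (i = i + - Posz n * l + Posz (n * absz l))%R by lia.
  by rewrite {1}Ei distC line_dist //; nia.
have [E|E] := eq_or_neg s s0.
  have [||d d0] := @eventually_separated h^-1 (f (org (p i))) y' s0 (maxn M' 1).
  - by move=> n; rewrite -(hy' (- Posz n)%R) expgzN expVgn.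
  - by rewrite E.
  rewrite expVgn => hd; apply: (axis_not_estab ax d0).
  by rewrite -{1}hd eactVK.
have [||d d0] := @eventually_separated h (f (org (p i))) y' s0 (maxn M 1).
- by move=> n; rewrite -(hy' (Posz n)).
- by rewrite E negbK.
exact: axis_not_estab ax d0.
Qed.

Hypothesis GG_one_sided : forall g x, GG g -> one_sided (x * g * x^-1).

(* An axis through two edges at [v] enters [v] by one and leaves by the other. *)
Lemma wh_adj_colour v b b' s :
  wh_adj GG v b b' -> end_colour chi b s -> end_colour chi b' (~~ s) -> False.
Proof.
move=> [vb vb' ne [g [x [p [gg ax [i bi] [j bj]]]]]] eb eb'.
have [po pr _] := ax; have os := GG_one_sided x gg.
have oinj (m n : int) : org (p m) = org (p n) -> m = n.
  move=> E; have := line_half (gtree_tree T) po pr m n.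
  have := line_half (gtree_tree T) po pr n m.
  by rewrite -E half_org E half_org; lia.
rewrite /wh_vertices /= in vb vb'.
case: bi => bi; case: bj => bj.
- by apply: ne; rewrite -bi -bj; congr p; apply: oinj; rewrite bi bj vb.
- have E : i = (j + 1)%R by apply: oinj; rewrite po bi bj term_rev vb.
  apply: (@axis_colours _ p i s ax os); first by rewrite bi.
  by rewrite E GRing.addrK bj erev_involutive.
- have E : j = (i + 1)%R by apply: oinj; rewrite po bi bj term_rev vb'.
  apply: (@axis_colours _ p j (~~ s) ax os); first by rewrite bj.
  by rewrite E GRing.addrK bi erev_involutive negbK.
- apply: ne; apply: erev_inj; rewrite -bi -bj; congr p.
  apply: (@GRing.addIr _ 1%R); apply: oinj.
  by rewrite !po bi bj !term_rev vb.
Qed.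

Hypothesis A_sub : forall K, is_subgroup K -> (forall g, K g -> eact g e = e) -> A K.
Variable v : vert T.
Hypothesis v_colours : forall s, exists2 b, org b = v & end_colour chi b s.
Hypothesis v_other : forall b b', org b = v -> org b' = v ->
  (forall s, ~ end_colour chi b s) -> (forall s, ~ end_colour chi b' s) -> b = b'.

Let fixv k : vact k v = v -> vact k (f v) = f v.
Proof. by move=> kv; rewrite -f_act kv. Qed.

(** The colour [~~ s] is then the good one. *)
Lemma good_colour : exists s, forall k, vact k v = v -> ~ disjoint_sides e s k.
Proof.
have [[k [/fixv kv dk]]|nk] :=
    pselect (exists k, vact k v = v /\ disjoint_sides e true k).
  exists false => k' /fixv k'v dk'.
  exact: disjoint_sides_exclusive kv k'v dk dk'.
by exists true => k kv dk; apply: nk; exists k.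
Qed.

Lemma chi_act k u : chi (vact k u) = thalf e (vact k (f u)).
Proof. by rewrite /chi f_act. Qed.

Lemma wh_stabP (C : set (edge T)) g :
  wh_stab v C g <-> vact g v = v /\ forall c, C (eact g c) <-> C c.
Proof.
split=> [[gv gC]|[gv gC]]; split=> //.
  move=> c; split=> [|Cc]; last by rewrite -gC; exists c.
  by rewrite -{1}gC => -[c' Cc' /eact_inj <-].
apply/seteqP; split=> [_ [c Cc <-]|c Cc]; first exact/gC.
by exists (eact g^-1 c); rewrite ?eactVK //; apply/gC; rewrite eactVK.
Qed.

Lemma wh_stab_subgroup (C : set (edge T)) : is_subgroup (wh_stab v C).
Proof.
split=> [|x y /wh_stabP[xv xC] /wh_stabP[yv yC]|x /wh_stabP[xv xC]]; apply/wh_stabP.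
- by split; [exact: vact1|move=> c; rewrite eact1].
- split=> [|c]; first by rewrite vactM yv.
  by rewrite eactM; exact: iff_trans (xC _) (yC _).
- split=> [|c]; first by rewrite -{1}xv vactK.
  by rewrite -(xC (eact x^-1 c)) eactVK.
Qed.

Section GoodColour.
Variable s : bool.
Hypothesis s_good : forall k, vact k v = v -> ~ disjoint_sides e s k.

(* Two far vertices of the same colour, one translated to the other, show that
   the sides of that colour of [e] and of its translate meet. *)
Lemma good_colour_stab k b : vact k v = v -> org b = v ->
  end_colour chi b (~~ s) -> end_colour chi (eact k b) (~~ s) -> eact k e = e.
Proof.
move=> kv ob [M HM] [M' HM'].
have [u hu du] := far_point b (maxn M M').
have cu : chi u = ~~ s by apply: HM => //; apply: leq_trans du; exact: leq_maxl.
have cku : chi (vact k u) = ~~ s.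
  apply: HM'; first by rewrite half_act.
  by rewrite act_org dist_act; apply: leq_trans du; exact: leq_maxr.
have nd : ~ disjoint_sides e (~~ s) k.
  move=> d; apply: (d (vact k (f u))); first by rewrite half_act.
  by rewrite -f_act.
have none s' : ~ disjoint_sides e s' k by case: (eq_or_neg s s') => ->; [exact: s_good|].
by have [//|/none|/none] := elliptic_trichotomy e (fixv kv).
Qed.

(* Both colours occur far beyond [b], so both sides of the translate of [e] meet
   the side of the good colour. *)
Lemma mixed_not_to_good k b : vact k v = v -> org b = v ->
  (forall s', ~ end_colour chi b s') -> ~ end_colour chi (eact k b) (~~ s).
Proof.
move=> kv ob nb [M HM].
have far u : thalf b u -> M <= tdist (org b) u -> chi (vact k u) = ~~ s.
  by move=> hu du; apply: HM; rewrite ?half_act // act_org dist_act.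
have [u [hu du cu]] := not_end_colour (nb s) M.
have [u' [hu' du' cu']] := not_end_colour (nb (~~ s)) M.
have nd : ~ disjoint_sides e (~~ s) k.
  move=> d; apply: (d (vact k (f u))); first by rewrite half_act.
  by rewrite -f_act; exact: far.
have nE : eact k e <> e.
  move=> E; have := far u' hu' du'; rewrite chi_act -{1}E half_act -/(chi u') cu'.
  by case: (s).
have none s' : ~ disjoint_sides e s' k by case: (eq_or_neg s s') => ->; [exact: s_good|].
by have [//|/none|/none] := elliptic_trichotomy e (fixv kv).
Qed.

Let R := wh_adj GG v.
Let V := @wh_vertices _ T v.
Let symR x y : R x y -> R y x. Proof. exact: wh_adj_sym. Qed.

Let colour_cases b :
  [\/ end_colour chi b s, end_colour chi b (~~ s) | forall s', ~ end_colour chi b s'].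
Proof.
have [h|n1] := pselect (end_colour chi b s); first by constructor 1.
have [h|n2] := pselect (end_colour chi b (~~ s)); first by constructor 2.
by constructor 3 => s'; case: (eq_or_neg s s') => ->.
Qed.

Let colour_excl b : end_colour chi b s -> end_colour chi b (~~ s) -> False.
Proof. by move=> h1 /(end_colour_unique h1); case: (s). Qed.

(** Write the edges at [v] as those of the good colour, those of the colour [s]
    and at most one mixed edge [p]; no edge of one colour is adjacent to one of
    the other. An element of the stabilizer of [v] that maps a good edge to a
    good edge fixes [e], which bounds the stabilizers. *)
Lemma good_colour_admissible_cut : has_admissible_cut GG v A.
Proof.
have [b0 ob0 eb0] := v_colours s; have [b1 ob1 eb1] := v_colours (~~ s).
have step b c : R b c -> end_colour chi b (~~ s) -> ~ end_colour chi c s.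
  by move=> /symR r eb ec; exact: wh_adj_colour r ec eb.
have [[b [ob eb inC]]|noC] := pselect (exists b, [/\ org b = v, end_colour chi b (~~ s) &
    forall c, joined R V b c -> end_colour chi c (~~ s)]).
  left; exists (component R V b); split.
  - by exists b, b0; split=> // /inC; exact: colour_excl.
  - by exists b.
  - apply: A_sub => [|k [kv kC]]; first exact: wh_stab_subgroup.
    have Cb : component R V b b by split=> //; exact: rt_refl.
    apply: (@good_colour_stab k b) => //; apply: inC.
    by have : component R V b (eact k b) by [rewrite -kC; exists b]; case.
have [p op mp] : exists2 p, org p = v & forall s', ~ end_colour chi p s'.
  apply: contrapT => np; apply: noC; exists b1; split=> // c.
  move: c; apply: joined_ind => // x y vx vy _ r ex.
  have [h|//|h] := colour_cases y; first by case: (step _ _ r ex h).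
  by case: np; exists y.
have to_p b : org b = v -> end_colour chi b (~~ s) -> joined R V p b.
  move=> ob eb; apply: joined_sym => //; apply: contrapT => nj; apply: noC.
  exists b; split=> // c; move: c; apply: joined_ind => // x y vx vy bx r ex.
  have [h|//|h] := colour_cases y; first by case: (step _ _ r ex h).
  case: nj; rewrite (v_other op vy mp h).
  by apply: rt_trans bx _; apply: rt_step.
have orgact k b : vact k v = v -> org b = v -> org (eact k b) = v.
  by move=> kv ob; rewrite act_org ob.
pose W := component R V p.
have [[x [Wx ex]]|noW] := pselect (exists x, W x /\ end_colour chi x s); last first.
  (* The component of [p] consists of [p] and of one colour. *)
  left; exists W; split.
  - by exists p, b0; split=> // pb0; apply: noW; exists b0.
  - by exists p.
  - apply: A_sub => [|k [kv kW]]; first exact: wh_stab_subgroup.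
    have WK c : W c -> W (eact k c) by move=> Wc; rewrite -kW; exists c.
    have Wp : W p by split=> //; exact: rt_refl.
    have kp : eact k p = p.
      have [h|h|h] := colour_cases (eact k p).
      + by case: noW; exists (eact k p); split=> //; exact: WK.
      + by case: (mixed_not_to_good kv op mp h).
      + by apply: v_other => //; exact: orgact.
    have Wb1 : W b1 by split=> //; exact: to_p.
    apply: (@good_colour_stab k b1) => //.
    have [h|//|h] := colour_cases (eact k b1).
    + by case: noW; exists (eact k b1); split=> //; exact: WK.
    + have E : eact k b1 = eact k p by rewrite kp; apply: v_other => //; exact: orgact.
      by case: (mp (~~ s)); rewrite -(eact_inj E).
(* Otherwise [p] separates the two colours in its component. *)
right; exists p; split=> //; cbv zeta; rewrite -/R -/V -/W.
have nep c s' : end_colour chi c s' -> c <> p by move=> h E; apply: (mp s'); rewrite -E.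
have stay c : joined R (W `\ p) b1 c -> end_colour chi c (~~ s).
  move: c; apply: joined_ind => // y z _ [[vz _] nz] _ r ey.
  have [h|//|h] := colour_cases z; first by case: (step _ _ r ey h).
  by case: nz; apply: v_other.
have Wb1 : (W `\ p) b1 by split; [split=> //; exact: to_p|exact: nep eb1].
split.
  exists b1, x; split=> //; first by split=> //; exact: nep ex.
  by move=> /stay; exact: colour_excl.
exists (component R (W `\ p) b1); first by exists b1.
by move=> k kv [_ /stay]; exact: mixed_not_to_good.
Qed.

End GoodColour.

Lemma bicoloured_vertex_admissible_cut : has_admissible_cut GG v A.
Proof. by have [s sP] := good_colour; exact: good_colour_admissible_cut sP. Qed.

End Whitehead.

(** All the vertices of the Whitehead graph are then isolated. *)
Lemma no_elements_admissible_cut (G : groupType) (A : set (set G)) (T : gtree G) :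
  cyclic_family A -> ~ is_Z G -> in_DA A T ->
  exists v : vert T, has_admissible_cut set0 v A.
Proof.
move=> [_ _ A3] nZ [[TV _] TA].
have [a] : exists a : edge T, True.
  apply: contrapT => na; apply: nZ; have [[o] _ con _] := gtree_tree T.
  rewrite /is_Z; suff -> : [set: G] = vstab o by exact: TV.
  apply/seteqP; split=> // g _; have [[//|c s] _] := con (vact g o) o.
  by case: na; exists c.
move=> _; exists (org a); left; exists [set a].
have nadj x y : ~ wh_adj set0 (org a) x y by move=> [_ _ _ [g [x' [p []]]]].
have compE : component (wh_adj set0 (org a)) (wh_vertices (org a)) a = [set a].
  apply/seteqP; split=> [c [_]|_ ->]; last by split=> //; exact: rt_refl.
  by move: c; apply: joined_ind => // u w _ _ _ /nadj.
split.
- have [b ob nb] := no_leaf (erev a); rewrite term_rev erev_involutive in ob nb.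
  exists a, b; split=> // ab; apply: nb.
  have : component (wh_adj set0 (org a)) (wh_vertices (org a)) a b by [].
  by rewrite compE.
- by exists a.
- have Astab : A (estab a) by apply: TA; [exact: estab_subgroup|exists a].
  apply: A3 Astab _ _; first exact: wh_stab_subgroup.
  move=> g [_ gC]; have : [set a] (eact g a) by rewrite -gC; exists a.
  by [].
Qed.

Theorem theorem2p14 (G : groupType) (A : set (set G)) (GG : set G)
  (hGBS : is_GBS G) (hne : non_elementary G) (hA : cyclic_family A)
  (hfin : finite_set GG) (hlox : forall g, GG g -> loxodromic g)
  (hsimple : simple_collection A GG) :
  forall T : gtree G, in_DA A T ->
    exists v : vert T, has_admissible_cut GG v A.
Proof.
move=> T TDA; have [nZ _ _] := hne.
have [Hs [[_ [TH [S SDA [F col]] HsE]] prop pre]] := hsimple.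
have [[g0 gg0]|nGG] := pselect (exists g, GG g); last first.
  have -> : GG = set0 by apply/seteqP; split=> // g gg; apply: nGG; exists g.
  exact: no_elements_admissible_cut.
have ell g : GG g -> exists2 w : vert TH, ~ elliptic_in_D (vstab w) &
    exists x, vstab w (x^-1 * g * x).
  move=> /pre[C]; rewrite HsE => -[w nw <-] [H [x _ <-] [k kw <-]].
  by exists w => //; exists x; rewrite !mulgA mulVg mul1g mulgVK.
have [w0 nw0 _] := ell g0 gg0.
have [SD SA] := SDA; have [TD _] := TDA; have [_ _ A3] := hA.
have [symF gF [q [j [qsurj qE _ _ [qact _]]]]] := col.
have [e nFe] : exists e, ~ F e.
  apply: contrapT => nF; apply: prop; rewrite HsE.
  have one (u w : vert TH) : u = w.
    have [u' <-] := qsurj u; have [w' <-] := qsurj w; apply/qE.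
    have [_ _ /(_ u' w')[s p] _] := gtree_tree S; exists s; apply: epath_sub p => c _.
    by apply: contrapT => nFc; apply: nF; exists c.
  have stabT (u : vert TH) : vstab u = [set: G] by apply/seteqP; split=> // g _; exact: one.
  apply/seteqP; split=> [_ [u _ <-]|_ ->]; first by rewrite stabT.
  by exists w0; rewrite ?stabT.
have [f f_act] := equivariant_map (vertex_groups_elliptic SD TD col nw0 nFe).
have [gs gen] := GBS_finitely_generated hGBS.
have [cs cs_all] := finitely_many_edge_orbits T gen.
have [v [v1 v2]] := bicoloured_vertex
  (@coboundary_bounded G S T f e f_act SD TD cs cs_all)
  (@colours_unbounded G S T f e f_act cs cs_all).
exists v; apply: (bicoloured_vertex_admissible_cut f_act SD TD _ _ v1 v2).
- move=> g x gg; have [w _ [z wz]] := ell g gg.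
  have [y' qy'] := qsurj (vact (x * z) w); exists y', (thalf e y') => k.
  have fixw : vstab (vact (x * z) w) (x * g * x^-1).
    rewrite /vstab /= -vactM -[in RHS]wz -vactM; congr vact.
    by rewrite !mulgA !mulgVK mulgK.
  have := subgroup_expgz k (vstab_subgroup _) fixw; set h := expgz _ k => fixh.
  have /qE[s ps] : q (vact h y') = q y' by rewrite qact qy'.
  apply: half_path ps => // /symF; rewrite erev_involutive; exact: nFe.
- move=> K subK Ke; apply: A3 (SA (estab e) (estab_subgroup e) _) subK Ke.
  by exists e.
Qed.
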